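(* A (finite) maximal triangle-free graph satisfies property $\mathscr{Q}_4$ if and only if it is a blow-up of either an Andrásfai graph $\Gamma_k$ ($k\ge1$) or a Vega graph $\Upsilon_i^{\mu\nu}$ ($i\ge2$, $\mu,\nu\in\{0,1\}$).
   Context: A graph is maximal triangle-free if it contains no triangle but adding any new edge creates a triangle. A blow-up of $H$ is any graph obtained by replacing each vertex of $H$ by a non-empty independent set and each edge of $H$ by the complete bipartite graph between the corresponding sets, with no further edges. Property $\mathscr{Q}_k$: for every $m\in\{1,\dots,k\}$ and every sequence $x_1,\dots,x_{3m}$ of (not necessarily distinct) vertices of $G$ there is an index set $I\subseteq[3m]$ such that $U=\{x_i:i\in I\}$ is independent and either $|I|\ge m+2$, or $|I|=m+1$ and $U$ has a common neighbour. Andrásfai graph $\Gamma_k$: vertex set $\mathbb Z/(3k-1)\mathbb Z$, $ij$ an edge iff $i-j\in\{k,\dots,2k-1\}$ mod $3k-1$. Vega graphs: for $i\ge2$, $\Upsilon_i^{00}$ has vertex set $\mathbb Z/(3i-1)\mathbb Z\cup\{a,b,c,u,v,w,x,y\}$; edges: those of $\Gamma_i$; the hexagon $av,vc,cu,ub,bw,wa$; all edges from $a,u$ to $\{0,\dots,i-1\}$; from $b,v$ to $\{i,\dots,2i-1\}$; from $c,w$ to $\{2i,\dots,3i-2\}$; and $xa,xb,xc,yu,yv,yw,xy$. Further $\Upsilon_i^{10}=\Upsilon_i^{00}-y$, $\Upsilon_i^{01}=\Upsilon_i^{00}-(2i-1)$, $\Upsilon_i^{11}=\Upsilon_i^{0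0}-\{y,2i-1\}$.
   Formalization: The graph is assumed to have at least two vertices: the one-vertex graph and the empty graph are vacuously maximal triangle-free and satisfy Q_4, but are not blow-ups of any Andrásfai or Vega graph. *)

(* Defs.v *)
From mathcomp Require Import all_boot.
Set Implicit Arguments. Unset Strict Implicit. Unset Printing Implicit Defensive.

(* A finite simple graph: T : finType with a symmetric irreflexive rel adj. *)

Definition triangle_free (T : finType) (adj : rel T) : Prop :=
  forall x y z : T, ~ (adj x y /\ adj y z /\ adj x z).

Definition add_edge (T : finType) (adj : rel T) (x y : T) : rel T :=
  fun u v => adj u v || ((u == x) && (v == y)) || ((u == y) && (v == x)).

Definition maximal_triangle_free (T : finType) (adj : rel T) : Prop :=
  triangle_free adj /\
  forall x y : T, x != y -> ~~ adj x y -> ~ triangle_free (add_edge adj x y).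

Definition independent (T : finType) (adj : rel T) (U : {set T}) : Prop :=
  forall u v, u \in U -> v \in U -> ~~ adj u v.

Definition common_neighbour (T : finType) (adj : rel T) (U : {set T}) : Prop :=
  exists z : T, forall u, u \in U -> adj z u.

Definition property_Q (k : nat) (T : finType) (adj : rel T) : Prop :=
  forall m : nat, 1 <= m <= k ->
  forall s : 'I_(3 * m) -> T,
  exists I : {set 'I_(3 * m)},
    let U := [set s i | i in I] in
    independent adj U /\
    (m + 2 <= #|I| \/ (#|I| = m + 1 /\ common_neighbour adj U)).

(* G (on T) is a blow-up of the induced subgraph of (V, e) on the vertex set S:
   a surjection f onto S with x ~ y iff f x ~ f y. The fibres are the
   (non-empty, independent since e is loopless) classes. *)
Definition blowup_on (T : finType) (adj : rel T) (V : finType) (e : rel V)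
    (S : pred V) : Prop :=
  exists f : T -> V,
    (forall x, S (f x)) /\
    (forall v, S v -> exists x, f x = v) /\
    (forall x y, adj x y = e (f x) (f y)).

Definition blowup (T : finType) (adj : rel T) (V : finType) (e : rel V) : Prop :=
  blowup_on adj e predT.

Definition andrasfai_adj (k : nat) (i j : 'I_(3 * k - 1)) : bool :=
  let d := (i + (3 * k - 1) - j) %% (3 * k - 1) in
             (k <= d) && (d <= 2 * k - 1).

(* Vega graphs.  Vertex type 'I_(3i-1) + 'I_8, the extra vertices being
   a=0, b=1, c=2, u=3, v=4, w=5, x=6, y=7. *)
Definition vega_letter_pairs : seq (nat * nat) :=
  [:: (0, 4); (4, 2); (2, 3); (3, 1); (1, 5); (5, 0)   (* hexagon av,vc,cu,ub,bw,wa *)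
   ; (6, 0); (6, 1); (6, 2)
   ; (7, 3); (7, 4); (7, 5)
   ; (6, 7)].

Definition vega_letter_adj (p q : nat) : bool :=
  ((p, q) \in vega_letter_pairs) || ((q, p) \in vega_letter_pairs).

Definition vega_letter_num (i p j : nat) : bool :=
  if (p == 0) || (p == 3) then j < i
  else if (p == 1) || (p == 4) then (i <= j) && (j <= 2 * i - 1)
  else if (p == 2) || (p == 5) then (2 * i <= j) && (j <= 3 * i - 2)
  else false.

Definition vega_adj (i : nat) : rel ('I_(3 * i - 1) + 'I_8) :=
  fun p q =>
    match p, q with
    | inl j, inl j' => andrasfai_adj (k:=i) j j'
    | inl j, inr l => vega_letter_num i l j
    | inr l, inl j => vega_letter_num i l j
    | inr l, inr l' => vega_letter_adj l l'
    end.

Definition vega_vertices (i : nat) (mu nu : bool) : pred ('I_(3 * i - 1) + 'I_8) :=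
  fun p =>
    match p with
    | inl j => ~~ (nu && (nat_of_ord j == 2 * i - 1))
    | inr l => ~~ (mu && (nat_of_ord l == 7))
    end.

Arguments andrasfai_adj k i j : clear implicits.
Arguments vega_adj i p q : clear implicits.
Arguments vega_vertices i mu nu p : clear implicits.

(* Main.v *)
Require Import Defs.
From mathcomp Require Import all_boot.
From mathcomp Require Import zify.

Set Implicit Arguments. Unset Strict Implicit. Unset Printing Implicit Defensive.

(* If the vertices of a graph carry weights for which every neighbourhood has more than a
   third of the total weight, then averaging produces, for any 3m vertices, a vertex adjacent
   to m + 1 of them; Andrasfai and Vega graphs carry such weights.

   Conversely, call a linear order with colours in Z/3 a word, and join x < y when the colour
   of y is the successor of that of x; Gamma_k is the word 0 1 2 0 1 2 ... of length 3k - 1.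
   A three-coloured graph in which no three vertices of different colours are independent
   comes from a word, and maximality forces the colours to increase by one along it.  Without
   an induced hexagon, G is three-colourable and independent triples have common neighbours,
   so G is a blow-up of a Gamma_k.  Otherwise G contains a hexagon a v c u b w with a common
   neighbour x of a, b, c, hence a Groetzsch graph, and one can choose the hexagon so that
   every vertex has two neighbours on it.  The vertices joined to two opposite hexagon
   vertices then form a word, the other vertices are clones of a, b, c, u, v, w, x or a further
   vertex y, and this is a Vega graph.

   What has to be known about the possible neighbourhoods in a Groetzsch graph follows from
   property_Q 4 by short case analyses, each case adding a common neighbour of a few known
   vertices.  They were found by a computer search and are replayed by a verified checker. *)

(** * Replaying case analyses on finite configurations *)

Definition disj (t u : bitseq) : bool := ~~ has (fun p => p.1 && p.2) (zip t u).

Definition restrict (m : seq nat) (t : bitseq) : bitseq := [seq nth false t i | i <- m].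

Definition add_row (rows : seq bitseq) (t : bitseq) : seq bitseq :=
  rcons [seq rcons p.1 p.2 | p <- zip rows t] (rcons t false).

Definition extend (traces : seq bitseq) (t : bitseq) : seq bitseq :=
  flatten [seq rcons u false :: (if disj u t then [:: rcons u true] else [::]) | u <- traces].

Definition weight (w : seq nat) (t : bitseq) : nat :=
  foldr (fun p k => if p.2 then p.1 + k else k) 0 (zip w t).

(* Bounds the weight of every independent set, so that the alternative with [m + 2] indices in
   [property_Q] is excluded. *)
Fixpoint max_weight (tails : seq bitseq) (w : seq nat) (forb : bitseq) : nat :=
  match tails, w with
  | r :: tails', k :: w' =>
    let skip := max_weight tails' w' (behead forb) in
    if (k == 0) || head false forb then skip
    else maxn skip (k + max_weight tails' w' [seq p.1 || p.2 | p <- zip (behead forb) r])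
  | _, _ => 0
  end.

Definition tails_of (rows : seq bitseq) : seq bitseq :=
  [seq drop i.+1 (nth [::] rows i) | i <- iota 0 (size rows)].

(* [Pair i j]: the non-adjacent vertices [i], [j] have a common neighbour.  [Weigh w]:
   [property_Q 4] for the sequence containing vertex [i] exactly [w_i] times. *)
Inductive rule := Pair of nat & nat | Weigh of seq nat.

Definition hits (r : rule) (t : bitseq) : bool :=
  match r with
  | Pair i j => nth false t i && nth false t j
  | Weigh w => sumn w %/ 3 < weight w t
  end.

Definition valid (rows : seq bitseq) (r : rule) : bool :=
  match r with
  | Pair i j => [&& i < size rows, j < size rows & ~~ nth false (nth [::] rows i) j]
  | Weigh w =>
    let m := sumn w %/ 3 in
    [&& size w == size rows, sumn w == 3 * m, 0 < m, m <= 4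
      & max_weight (tails_of rows) w (nseq (size rows) false) <= m.+1]
  end.

Definition pattern : Type := (seq bitseq * pred bitseq)%type.

Definition is_copy (rows : seq bitseq) (p : pattern) (m : seq nat) : bool :=
  all (fun i => i < size rows) m && ([seq restrict m (nth [::] rows i) | i <- m] == p.1).

Definition no_pattern : pattern := ([::], fun=> false).

Definition prune (pats : seq pattern) (rows : seq bitseq)
    (copies : seq (nat * seq nat)) (traces : seq bitseq) : seq bitseq :=
  foldl (fun tr c =>
    let p := nth no_pattern pats c.1 in
    if is_copy rows p c.2 then [seq t <- tr | ~~ p.2 (restrict c.2 t)] else tr)
  traces copies.

(* A certificate treats in turn the traces, on a vertex list with known adjacency matrix, of
   the vertices that are to be excluded.  [Leaf k m v rest]: adding such a vertex creates a
   copy [m] of the [k]-th pattern for which vertex [v] has a forbidden trace.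
   [Node copies r sub rest]: after adding it, discard the traces forbidden by the listed
   copies of patterns; rule [r] then yields a further vertex, excluded by [sub]. *)
Inductive cert :=
| Done
| Leaf of nat & seq nat & nat & cert
| Node of seq (nat * seq nat) & rule & cert & cert.

Fixpoint check (pats : seq pattern) (c : cert) (rows traces todo : seq bitseq) : bool :=
  match c with
  | Done => nilp todo
  | Leaf k m v rest =>
    if todo is t :: todo' then
      let rows' := add_row rows t in
      let p := nth no_pattern pats k in
      [&& v < size rows', is_copy rows' p m, p.2 (restrict m (nth [::] rows' v))
        & check pats rest rows traces todo']
    else false
  | Node copies r sub rest =>
    if todo is t :: todo' then
      let rows' := add_row rows t in
      let traces' := prune pats rows' copies (extend traces t) in
      [&& valid rows' r, check pats sub rows' traces' [seq u <- traces' | hits r u]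
        & check pats rest rows traces todo']
    else false
  end.

Definition traces_of (rows : seq bitseq) : seq bitseq :=
  foldl (fun tr i => extend tr (take i (nth [::] rows i))) [:: [::]] (iota 0 (size rows)).

Definition refute (pats : seq pattern) (rows traces : seq bitseq)
    (bad : pred bitseq) (c : cert) : bool :=
  check pats c rows traces [seq t <- traces | bad t].

Definition refute_base (pats : seq pattern) (rows traces : seq bitseq) (c : cert) : bool :=
  if c is Node copies r sub _ then
    let traces' := prune pats rows copies traces in
    valid rows r && check pats sub rows traces' [seq u <- traces' | hits r u]
  else false.

Section Soundness.
Variables (T : finType) (adj : rel T) (x0 : T).
Hypotheses (adj_sym : symmetric adj) (adj_irr : irreflexive adj).
Hypothesis tf : triangle_free adj.
Hypothesis common : forall x y, ~~ adj x y -> exists z, adj z x && adj z y.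
Hypothesis Q4 : property_Q 4 adj.

Definition trace (s : seq T) (g : T) : bitseq := [seq adj g x | x <- s].
Definition gram (s : seq T) : seq bitseq := [seq trace s z | z <- s].

Definition avoids (p : pattern) : Prop :=
  forall s, gram s = p.1 -> forall g, ~~ p.2 (trace s g).

Lemma size_trace s g : size (trace s g) = size s. Proof. by rewrite size_map. Qed.
Lemma size_gram s : size (gram s) = size s. Proof. by rewrite size_map. Qed.

Lemma trace_rcons s z g : trace (rcons s z) g = rcons (trace s g) (adj g z).
Proof. by rewrite /trace map_rcons. Qed.

Lemma gram_rcons s z : gram (rcons s z) = add_row (gram s) (trace s z).
Proof.
rewrite /gram map_rcons trace_rcons adj_irr /add_row; congr rcons.
rewrite /trace zip_map -map_comp; apply: eq_map => x /=.
by rewrite [LHS]trace_rcons adj_sym.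
Qed.

Lemma disj_trace s g z : adj g z -> disj (trace s g) (trace s z).
Proof.
move=> gz; apply/hasPn => p; rewrite /trace zip_map => /mapP[x _ ->] /=.
by apply/negP => /andP[gx zx]; apply: (tf (x := g) (y := z) (z := x)).
Qed.

Lemma extend_complete s z tr :
  (forall g, trace s g \in tr) -> forall g, trace (rcons s z) g \in extend tr (trace s z).
Proof.
move=> tr_all g; apply/flatten_mapP; exists (trace s g) => //.
rewrite trace_rcons; case gz: (adj g z); rewrite !inE ?eqxx //.
by rewrite disj_trace // inE eqxx orbT.
Qed.

Lemma nth_gram s i : i < size s -> nth [::] (gram s) i = trace s (nth x0 s i).
Proof. by move=> lt_i; rewrite (nth_map x0). Qed.

Lemma restrict_trace s m g : all (fun i => i < size s) m ->
  restrict m (trace s g) = trace [seq nth x0 s i | i <- m] g.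
Proof.
move=> /allP lt_m; rewrite /restrict /trace -map_comp.
by apply/eq_in_map => i /lt_m lt_i /=; rewrite (nth_map x0).
Qed.

Lemma is_copyP s p m : is_copy (gram s) p m ->
  all (fun i => i < size s) m /\ gram [seq nth x0 s i | i <- m] = p.1.
Proof.
rewrite /is_copy size_gram => /andP[lt_m /eqP <-]; split=> //.
rewrite /gram -map_comp; apply/eq_in_map => i im /=.
by rewrite nth_gram ?(allP lt_m) // restrict_trace.
Qed.

Lemma nth_avoids pats k : (forall p, List.In p pats -> avoids p) ->
  avoids (nth no_pattern pats k).
Proof.
elim: pats k => [|p pats IH] [|k] av //=; first by apply: av; left.
by apply: IH => q qp; apply: av; right.
Qed.

Lemma copy_avoids pats s k m g : (forall p, List.In p pats -> avoids p) ->
  is_copy (gram s) (nth no_pattern pats k) m ->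
  ~~ (nth no_pattern pats k).2 (restrict m (trace s g)).
Proof.
by move=> av /is_copyP[lt_m eqg]; rewrite restrict_trace //; apply: (nth_avoids av).
Qed.

Lemma prune_complete pats s copies tr : (forall p, List.In p pats -> avoids p) ->
  (forall g, trace s g \in tr) -> forall g, trace s g \in prune pats (gram s) copies tr.
Proof.
move=> av; rewrite /prune; elim: copies tr => [|[k m] copies IH] tr tr_all //=.
apply: IH => g; case: ifP => // cp.
by rewrite mem_filter tr_all andbT (copy_avoids _ av cp).
Qed.

Lemma weight_count w s (P : pred T) : size w = size s ->
  weight w [seq P x | x <- s] = count P (flatten [seq nseq p.1 p.2 | p <- zip w s]).
Proof.
elim: s w => [|x s IH] [|k w] //= [sz]; rewrite count_cat -IH //= /weight /=.
by rewrite count_nseq; case: (P x); rewrite /= ?mul1n ?mul0n.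
Qed.

Lemma max_weight_bound (U : pred T) (s : seq T) (tails : seq bitseq) w (F : pred T) :
  (forall x y, U x -> U y -> ~~ adj x y) -> (forall x, F x -> ~~ U x) ->
  size w = size s -> tails = tails_of (gram s) ->
  weight w [seq U x | x <- s] <= max_weight tails w [seq F x | x <- s].
Proof.
move=> ind; elim: s tails w F => [|x s IH] tails [|k w] F FU //= [sz] ->.
rewrite {1}/tails_of [iota _ _]/= [map _ (_ :: _)]/= /= drop0.
set tl := [seq drop _ _ | i <- _].
have tlE : tl = tails_of (gram s).
  rewrite /tl /tails_of !size_map -[1]/(1 + 0) iotaDl -map_comp.
  apply/eq_in_map => i /=; rewrite mem_iota add0n => /andP[_ lt_i].
  by rewrite !(nth_map x0) //= add1n.
have skip : weight w [seq U y | y <- s] <= max_weight tl w [seq F y | y <- s].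
  exact: IH.
rewrite /weight /= -/(weight w [seq U y | y <- s]); case: (boolP ((k == 0) || F x)) => [|_].
  by case/orP => [/eqP->|/FU/negbTE->] //; case: (U x).
rewrite leq_max; case Ux: (U x); last by rewrite skip.
rewrite leq_add2l; apply/orP; right.
rewrite /trace zip_map -map_comp.
apply: (IH _ _ (fun y => F y || adj x y)) => // y /orP[/FU //|xy].
by apply/negP => Uy; move: (ind _ _ Ux Uy); rewrite xy.
Qed.

Lemma card_nth_count n (xs : seq T) (P : pred T) : size xs = n ->
  #|[set i : 'I_n | P (nth x0 xs i)]| = count P xs.
Proof.
move=> sz; rewrite cardsE cardE size_filter -{2}(mkseq_nth x0 xs) /mkseq sz -val_enum_ord -map_comp.
by rewrite count_map enumT.
Qed.

Lemma hit_exists s r : valid (gram s) r -> exists g, hits r (trace s g).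
Proof.
case: r => [i j|w] /=; rewrite !size_gram.
  move=> /and3P[lt_i lt_j]; rewrite nth_gram // (nth_map x0) // => /common[z].
  by exists z; rewrite !(nth_map x0).
set m := sumn w %/ 3.
case/and5P=> /eqP szw /eqP sumw m_gt0 m_le4 mw.
pose xs := flatten [seq nseq p.1 p.2 | p <- zip w s].
have szx : size xs = 3 * m.
  rewrite -sumw /xs; elim: (s) (w) szw => [|x s' IH] [|k w'] //= [sz].
  by rewrite size_cat size_nseq IH.
have m14 : 1 <= m <= 4 by rewrite m_gt0.
have [I [ind alt]] := Q4 m14 (fun i => nth x0 xs i).
set U := [set _ | i in I] in ind alt.
have cardI (P : pred T) : (forall u, u \in U -> P u) -> #|I| <= weight w [seq P x | x <- s].
  move=> UP; rewrite weight_count // -(card_nth_count P szx).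
  by apply/subset_leq_card/subsetP => i iI; rewrite inE; apply/UP/imset_f.
case: alt => [|[cI [z zU]]].
  rewrite leqNgt => /negP[]; rewrite addn2 ltnS.
  apply: leq_trans (cardI (mem U) _) _ => //.
  apply: leq_trans mw.
  have -> : nseq (size s) false = [seq pred0 x | x <- s] by elim: (s) => //= x s' ->.
  by apply: max_weight_bound.
by exists z; rewrite -[m.+1]addn1 -cI; apply: cardI => u /zU.
Qed.

Lemma check_sound pats c s tr todo : (forall p, List.In p pats -> avoids p) ->
  (forall g, trace s g \in tr) -> check pats c (gram s) tr todo ->
  forall g, trace s g \notin todo.
Proof.
move=> av; elim: c s tr todo => [|k m v rest IH|copies r sub IHs rest IHr] s tr [|t todo] //= tr_all.
- case/and4P=> lt_v cp badv /(IH _ _ _ tr_all) rest_ok g; rewrite inE negb_or rest_ok andbT.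
  apply/eqP => tg; move: lt_v cp badv; rewrite -tg -gram_rcons size_gram => lt_v cp.
  by rewrite nth_gram // (negbTE (copy_avoids _ av cp)).
- case/and3P=> val sub_ok /(IHr _ _ _ tr_all) rest_ok g; rewrite inE negb_or rest_ok andbT.
  apply/eqP => tg; move: val sub_ok; rewrite -tg -gram_rcons => val sub_ok.
  have tr'_all := prune_complete copies av (extend_complete g tr_all).
  have [z hz] := hit_exists val.
  by have := IHs _ _ _ tr'_all sub_ok z; rewrite mem_filter hz tr'_all.
Qed.

Lemma traces_complete s g : trace s g \in traces_of (gram s).
Proof.
have take_gram k : k <= size s -> forall g, trace (take k s) g \in
    foldl (fun tr i => extend tr (take i (nth [::] (gram s) i))) [:: [::]] (iota 0 k).
  elim: k => [|k IH] lt_k h; first by rewrite take0.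
  rewrite -addn1 iotaD foldl_cat /= add0n addn1 (take_nth x0) // nth_gram //.
  rewrite {2}/trace -map_take -/(trace _ _).
  by apply: extend_complete; apply: IH; apply: ltnW.
by have := take_gram _ (leqnn _) g; rewrite take_size /traces_of size_gram.
Qed.

Lemma refute_sound pats s tr bad c : (forall p, List.In p pats -> avoids p) ->
  (forall g, trace s g \in tr) -> refute pats (gram s) tr bad c ->
  forall g, ~~ bad (trace s g).
Proof.
move=> av tr_all /(check_sound av tr_all) ok g; apply/negP => badg.
by move: (ok g); rewrite mem_filter badg tr_all.
Qed.

Lemma refute_base_sound pats s tr c : (forall p, List.In p pats -> avoids p) ->
  (forall g, trace s g \in tr) -> refute_base pats (gram s) tr c -> False.
Proof.
move=> av tr_all; case: c => // copies r sub _ /= /andP[val sub_ok].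
have tr'_all := prune_complete copies av tr_all.
have [z hz] := hit_exists val.
by have := check_sound av tr'_all sub_ok z; rewrite mem_filter hz tr'_all.
Qed.

End Soundness.

(** * Words over Z/3 *)

Definition word_adj (i j : nat) : bool :=
  ((i < j) && ((j - i) %% 3 == 1)) || ((j < i) && ((i - j) %% 3 == 1)).

Lemma mod3_succ_or a b : a < 3 -> b < 3 -> a != b -> b = a.+1 %% 3 \/ a = b.+1 %% 3.
Proof. by case: a => [|[|[|//]]]; case: b => [|[|[|//]]] //; [left|right|right|left|left|right]. Qed.

Lemma mod3_third a b c : a < 3 -> b < 3 -> c < 3 -> b = a.+1 %% 3 -> c != a -> c != b ->
  c = b.+1 %% 3 /\ a = c.+1 %% 3.
Proof. by case: a => [|[|[|//]]]; case: b => [|[|[|//]]]; case: c => [|[|[|//]]]. Qed.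

Lemma mod3_succ_neq a : a < 3 -> a.+1 %% 3 != a.
Proof. by case: a => [|[|[|]]]. Qed.

Lemma mod3_succ_anti a b : b < 3 -> a = b.+1 %% 3 -> b != a.+1 %% 3.
Proof. by case: b => [|[|[|//]]] _ ->. Qed.

Lemma mod3_diff_eq p i j : i < j -> (p + i) %% 3 = (p + j) %% 3 -> ((j - i) %% 3 == 1) = false.
Proof. by move=> lt_ij /eqP; rewrite eq_sym eqn_mod_dvd ?leq_add2l ?subnDl ?(ltnW lt_ij) // => /eqP->. Qed.

Lemma mod3_diff_next p i j : i < j -> (p + j) %% 3 = ((p + i) %% 3).+1 %% 3 -> (j - i) %% 3 == 1.
Proof.
move=> lt_ij /eqP; rewrite -(addn1 (_ %% 3)) modnDml eqn_mod_dvd -addnA addn1 ?leq_add2l //.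
by rewrite subnDl; lia.
Qed.

Lemma mod3_diff_prev p i j : i < j -> (p + i) %% 3 = ((p + j) %% 3).+1 %% 3 ->
  ((j - i) %% 3 == 1) = false.
Proof.
move=> lt_ij cE; apply/negbTE/negP => /eqP d1; move: cE.
rewrite -{1}(subnKC (ltnW lt_ij)) addnA -(modnDmr (p + i)) d1.
by clear; lia.
Qed.

Section Word.
Variables (T : finType) (adj : rel T) (D : pred T) (c : T -> nat).
Hypothesis adj_sym : symmetric adj.
Hypothesis tf : triangle_free adj.
Hypothesis c_lt : forall x, D x -> c x < 3.
Hypothesis c_adj : forall x y, D x -> D y -> adj x y -> c x != c y.
Hypothesis c_common : forall x y, D x -> D y -> c x != c y -> ~~ adj x y ->
  exists z, [/\ D z, adj z x & adj z y].
Hypothesis no_rainbow : forall x y z, D x -> D y -> D z ->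
  c x != c y -> c y != c z -> c x != c z ->
  ~~ adj x y -> ~~ adj y z -> ~~ adj x z -> False.

Definition before (x y : T) : bool :=
  [&& D x, D y & if c y == (c x).+1 %% 3 then adj x y
                 else (c x == (c y).+1 %% 3) && ~~ adj x y].

Lemma before_adj x y : D x -> D y -> c y = (c x).+1 %% 3 -> before x y = adj x y.
Proof. by rewrite /before => -> -> ->; rewrite eqxx. Qed.

Lemma before_nadj x y : D x -> D y -> c x = (c y).+1 %% 3 -> before x y = ~~ adj x y.
Proof.
move=> Dx Dy cE; rewrite /before Dx Dy {2}cE eqxx /=.
by rewrite (negbTE (mod3_succ_anti (c_lt Dy) cE)).
Qed.

Lemma succ_or x y : D x -> D y -> c x != c y ->
  c y = (c x).+1 %% 3 \/ c x = (c y).+1 %% 3.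
Proof. by move=> Dx Dy; apply: mod3_succ_or; apply: c_lt. Qed.

Lemma succ_neq x y : D x -> c y = (c x).+1 %% 3 -> c x != c y.
Proof. by move=> Dx ->; rewrite eq_sym mod3_succ_neq // c_lt. Qed.

Lemma before_col x y : before x y -> [/\ D x, D y & c x != c y].
Proof.
case/and3P=> Dx Dy; case: (c y =P _) => [/(succ_neq Dx) ? _|_ /andP[/eqP/(succ_neq Dy) + _]] //.
by rewrite eq_sym.
Qed.

Lemma before_total x y : D x -> D y -> c x != c y -> ~~ before x y -> before y x.
Proof.
move=> Dx Dy cxy; case: (succ_or Dx Dy cxy) => cE.
  by rewrite before_adj // before_nadj // adj_sym.
by rewrite before_nadj // before_adj // negbK adj_sym.
Qed.

Lemma before_anti x y : before x y -> ~~ before y x.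
Proof.
move=> bxy; have [Dx Dy cxy] := before_col bxy; move: bxy.
case: (succ_or Dx Dy cxy) => cE.
  by rewrite before_adj // before_nadj // adj_sym negbK.
by rewrite before_nadj // before_adj // adj_sym.
Qed.

Lemma third x y z : D x -> D y -> D z -> c y = (c x).+1 %% 3 -> c z != c x -> c z != c y ->
  c z = (c y).+1 %% 3 /\ c x = (c z).+1 %% 3.
Proof. by move=> Dx Dy Dz; apply: mod3_third; apply: c_lt. Qed.

Lemma before_trans3 x y z : before x y -> before y z -> c x != c z -> before x z.
Proof.
move=> bxy byz cxz; have [Dx Dy cxy] := before_col bxy; have [_ Dz cyz] := before_col byz.
apply: contraT => /(before_total Dx Dz cxz) bzx; exfalso; move: bxy byz bzx.
case: (succ_or Dx Dy cxy) => cE.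
  have [czy cxz'] : c z = (c y).+1 %% 3 /\ c x = (c z).+1 %% 3.
    by apply: third; rewrite // eq_sym.
  rewrite !before_adj // => xy yz; rewrite adj_sym => xz.
  exact: (tf (conj xy (conj yz xz))).
have [czx cyz'] : c z = (c x).+1 %% 3 /\ c y = (c z).+1 %% 3.
  by apply: third; rewrite // eq_sym.
rewrite !before_nadj // => xy yz; rewrite adj_sym => xz.
exact: (no_rainbow Dx Dy Dz).
Qed.

Lemma adj_nadj x y z : adj x y -> adj y z -> ~~ adj x z.
Proof. by move=> xy yz; apply/negP => xz; apply: (tf (conj xy (conj yz xz))). Qed.

(* A directed 4-cycle on two colours would be an induced 2K2; a common neighbour of
   two of its non-adjacent vertices completes a rainbow independent triple. *)
Lemma before_trans4 x y z w : before x y -> before y z -> before z w ->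
  c x = c z -> c y = c w -> before x w.
Proof.
move=> bxy byz bzw cxz cyw.
have [Dx Dy cxy] := before_col bxy; have [Dz Dw czw] := before_col bzw.
have cxw : c x != c w by rewrite -cyw.
apply: contraT => /(before_total Dx Dw cxw) bwx; exfalso; move: bxy byz bzw bwx.
case: (succ_or Dx Dy cxy) => cE.
  rewrite before_adj // before_nadj -?cxz // before_adj -?cxz -?cyw //.
  rewrite before_nadj -?cyw // => xy nyz zw nwx.
  have cyz : c y != c z by rewrite -cxz eq_sym.
  have [t [Dt ty tz]] := c_common Dy Dz cyz nyz.
  have cty := c_adj Dt Dy ty; have ctz := c_adj Dt Dz tz.
  apply: (no_rainbow Dx Dw Dt) => //; rewrite -?cyw ?cxz 1?eq_sym // 1?eq_sym //.
  - by rewrite adj_sym.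
  - by apply: (adj_nadj (y := z)); rewrite adj_sym // adj_sym.
  - by apply: (adj_nadj (y := y)); rewrite // adj_sym.
rewrite before_nadj // before_adj -?cxz // before_nadj -?cxz -?cyw //.
rewrite before_adj -?cyw // => nxy yz nzw wx.
have [t [Dt tx ty]] := c_common Dx Dy cxy nxy.
have cty := c_adj Dt Dy ty; have ctx := c_adj Dt Dx tx.
apply: (no_rainbow Dz Dw Dt) => //; rewrite -?cyw -?cxz 1?eq_sym // 1?eq_sym //.
- by apply: (adj_nadj (y := x)); rewrite // adj_sym.
- by apply: (adj_nadj (y := y)); rewrite adj_sym.
Qed.

Definition prec (x y : T) : bool :=
  before x y || ((c x == c y) && [exists z, before x z && before z y]).

Lemma before_prec x y z : before x y -> prec y z -> prec x z.
Proof.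
move=> bxy; case: (eqVneq (c x) (c z)) => cxz.
  case/orP => [byz|/andP[/eqP cyz _]].
    by apply/orP; right; rewrite cxz eqxx; apply/existsP; exists y; rewrite bxy.
  by have [_ _] := before_col bxy; rewrite cxz cyz eqxx.
case/orP => [byz|/andP[/eqP cyz /existsP[w /andP[byw bwz]]]].
  by apply/orP; left; apply: before_trans3 bxy byz cxz.
apply/orP; left; case: (eqVneq (c x) (c w)) => cxw.
  exact: before_trans4 bxy byw bwz cxw cyz.
exact: before_trans3 (before_trans3 bxy byw cxw) bwz cxz.
Qed.

Lemma prec_trans x y z : prec x y -> prec y z -> prec x z.
Proof.
case/orP => [|/andP[_ /existsP[w /andP[bxw bwy]]]] pyz; first exact: before_prec.
by apply: before_prec bxw _; apply: before_prec bwy _.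
Qed.

Lemma prec_irr x : ~~ prec x x.
Proof.
apply/negP => /orP[bxx|/andP[_ /existsP[z /andP[bxz bzx]]]].
  by move: (before_anti bxx); rewrite bxx.
by move: (before_anti bxz); rewrite bzx.
Qed.

Fixpoint height_fuel (k : nat) (x : T) : nat :=
  if k is k'.+1 then \max_(z | prec z x) (height_fuel k' z).+1 else 0.

Definition height (x : T) : nat := height_fuel #|T| x.

Lemma height_fuel_stable n k x : #|[pred z | prec z x]| <= n ->
  #|[pred z | prec z x]| <= k -> height_fuel n x = height_fuel k x.
Proof.
elim: n k x => [|n IH] [|k] x //=.
- by rewrite leqn0 => /eqP/card0_eq P0 _; rewrite big_pred0.
- by move=> _; rewrite leqn0 => /eqP/card0_eq P0; rewrite big_pred0.
move=> le_n le_k; apply: eq_bigr => z pzx; congr _.+1.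
have lt_z : #|[pred y | prec y z]| < #|[pred y | prec y x]|.
  apply/proper_card/properP; split.
    by apply/subsetP => y; rewrite !inE => /prec_trans; apply.
  by exists z; rewrite !inE // prec_irr.
by apply: IH; rewrite -ltnS; apply: leq_trans lt_z _.
Qed.

Lemma heightE x : height x = \max_(z | prec z x) (height z).+1.
Proof. by rewrite /height (height_fuel_stable (k := #|T|.+1)) ?max_card // ltnW // ltnS max_card. Qed.

Lemma height_lt x y : prec x y -> height x < height y.
Proof. by move=> pxy; rewrite (heightE y) (bigmax_sup x). Qed.

Lemma height_pred y l : height y = l.+1 -> exists x, before x y /\ height x = l.
Proof.
rewrite heightE; case: (pickP (prec^~ y)) => [x0 px0|P0]; last by rewrite big_pred0.
rewrite (bigop.bigmax_eq_arg x0) //; case: arg_maxnP => // x pxy x_max [hx].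
exists x; split=> //; case/orP: (pxy) => // /andP[_ /existsP[z /andP[bxz bzy]]].
have hxz : height x < height z by apply: height_lt; rewrite /prec bxz.
have pzy : prec z y by rewrite /prec bzy.
have : (height z).+1 <= (height x).+1 := x_max z pzy.
by rewrite ltnS leqNgt hxz.
Qed.

Lemma height_eq_col x y : D x -> D y -> height x = height y -> c x = c y.
Proof.
move=> Dx Dy hxy; apply/eqP; apply: contraT => cxy.
have [bxy|/(before_total Dx Dy cxy) byx] := boolP (before x y).
  by have := height_lt (x := x) (y := y); rewrite /prec bxy hxy ltnn => /(_ isT).
by have := height_lt (x := y) (y := x); rewrite /prec byx hxy ltnn => /(_ isT).
Qed.

(* A step to the other neighbouring colour would be a non-adjacent pair of consecutive
   levels, and its common neighbour would lie strictly between them. *)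
Lemma height_succ_col x y : D x -> D y -> height y = (height x).+1 -> c y = (c x).+1 %% 3.
Proof.
move=> Dx Dy hy'; have [z [bzy hz]] := height_pred hy'; have [Dz _ czy] := before_col bzy.
rewrite -(height_eq_col Dz Dx hz); case: (succ_or Dz Dy czy) => // cE.
have nzy : ~~ adj z y by rewrite -before_nadj.
have [w [Dw wz wy]] := c_common Dz Dy czy nzy.
have [cwz cyw] := third Dy Dz Dw cE (c_adj Dw Dy wy) (c_adj Dw Dz wz).
have bzw : prec z w by rewrite /prec before_adj // adj_sym wz.
have bwy : prec w y by rewrite /prec before_adj // wy.
by have := height_lt bwy; rewrite hy' ltnS -hz leqNgt (height_lt bzw).
Qed.

Lemma word_structure : (exists x, D x) ->
  exists (h : T -> nat) (n s : nat),
    [/\ s < 3, forall x, D x -> h x < n, forall l, l < n -> exists2 x, D x & h x = l,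
        forall x, D x -> c x = (s + h x) %% 3
      & forall x y, D x -> D y -> adj x y = word_adj (h x) (h y)].
Proof.
move=> [x0 Dx0].
pose n := \max_(x | D x) (height x).+1.
have lt_n x : D x -> height x < n by move=> Dx; rewrite /n (bigmax_sup x).
have level l : l < n -> exists2 x, D x & height x = l.
  have [x Dx nE] : {x | D x & n = (height x).+1}.
    rewrite /n (bigop.bigmax_eq_arg x0) //; case: arg_maxnP => // x Dx _.
    by exists x.
  rewrite nE ltnS => le_l; rewrite -(subKn le_l).
  elim: (height x - l) => [|k [y Dy hy]]; first by exists x; rewrite ?subn0.
  case: (leqP (height x) k) => [le_k|lt_k].
    by exists y => //; rewrite hy; lia.
  have [|z [bzy hz]] := @height_pred y (height x - k.+1); first by rewrite hy; lia.
  by have [Dz _ _] := before_col bzy; exists z.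
have [z Dz hz] := level 0 (leq_ltn_trans (leq0n _) (lt_n _ Dx0)).
have colE x : D x -> c x = (c z + height x) %% 3.
  move=> Dx; move hl: (height x) => l; elim: l x Dx hl => [|l IH] x Dx hx.
    rewrite addn0 modn_small; last exact: c_lt.
    by apply: height_eq_col; rewrite // hz.
  have [y [byx hy]] := height_pred hx; have [Dy _ _] := before_col byx.
  rewrite (height_succ_col Dy Dx); last by rewrite hx hy.
  by rewrite (IH y) // -addn1 modnDml addn1 addnS.
exists height, n, (c z); split=> //; first exact: c_lt.
have adjE x y : D x -> D y -> height x < height y ->
    adj x y = ((height y - height x) %% 3 == 1).
  move=> Dx Dy lt_xy; case: (eqVneq (c x) (c y)) => cxy.
    have -> : adj x y = false by apply/negbTE/negP => /(c_adj Dx Dy); rewrite cxy eqxx.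
    by symmetry; apply: (mod3_diff_eq (p := c z)); rewrite -?colE.
  have bxy : before x y.
    apply: contraT => /(before_total Dx Dy cxy) byx.
    by have := height_lt (x := y) (y := x); rewrite /prec byx => /(_ isT); rewrite ltnNge ltnW.
  case: (succ_or Dx Dy cxy) => cE.
    rewrite -before_adj // bxy; symmetry.
    by apply: (mod3_diff_next (p := c z)); rewrite -?colE.
  have /negbTE-> : ~~ adj x y by rewrite -before_nadj.
  by symmetry; apply: (mod3_diff_prev (p := c z)); rewrite -?colE.
move=> x y Dx Dy; rewrite /word_adj; case: (ltngtP (height x) (height y)) => hxy.
- by rewrite adjE // orbF.
- by rewrite adj_sym adjE.
by apply/negbTE/negP => /(c_adj Dx Dy); rewrite (height_eq_col Dx Dy hxy) eqxx.
Qed.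
End Word.

(** * Configurations around a hexagon *)

(* Vertices 0, ..., 6 are the letters a, b, c, u, v, w, x, and [7 + j] is the [j]-th vertex of
   a word whose colours 0, 1, 2 are joined to {a, u}, {b, v}, {c, w}.  [core 0] is a hexagon
   with a centre and [core 4] is the Groetzsch graph. *)
Definition core_adj (i j : nat) : bool :=
  if i < 7 then
    if j < 7 then vega_letter_adj i j else (i < 6) && (i %% 3 == (j - 7) %% 3)
  else
    if j < 7 then (j < 6) && (j %% 3 == (i - 7) %% 3) else word_adj (i - 7) (j - 7).

Definition core (n : nat) : seq bitseq :=
  [seq [seq core_adj i j | j <- iota 0 (7 + n)] | i <- iota 0 (7 + n)].

Definition bits (n : nat) (l : seq nat) : bitseq := [seq i \in l | i <- iota 0 n].

Definition core4_auts : seq (seq nat) :=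
  [:: [:: 0;1;2;3;4;5;6;7;8;9;10]; [:: 0;1;9;8;10;6;5;7;3;2;4]; [:: 0;2;1;3;5;4;6;10;9;8;7];
      [:: 0;2;8;9;7;6;4;10;3;1;5]; [:: 0;3;8;1;4;10;7;6;2;9;5]; [:: 0;3;9;2;5;7;10;6;1;8;4];
      [:: 0;8;2;9;6;7;4;5;1;3;10]; [:: 0;8;3;1;10;4;7;5;9;2;6]; [:: 0;9;1;8;6;10;5;4;2;3;7];
      [:: 0;9;3;2;7;5;10;4;8;1;6]].

(* Up to automorphism, the independent subsets of [core 4] that are not the trace of a vertex,
   in an order in which each exclusion only uses the previous ones. *)
Definition impossible : seq bitseq :=
  [seq bits 11 l | l <- [:: [:: 3;4;5]; [:: 4;5;7]; [:: 4;5;6;7]; [:: 4;5]; [:: 4;5;6]; [:: 1;4];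
    [:: 1;2]; [:: 1]; [:: 4]; [:: 4;6]; [::]; [:: 3;6]; [:: 0]]].

(* The traces that only occur in the presence of a [core 6]. *)
Definition deficient : seq bitseq :=
  [seq bits 11 l | l <- [:: [:: 0;1]; [:: 1;2;7]; [:: 3;4;6]]].

(* The trace of the vertex y, and its images having fewer than two vertices on the hexagon. *)
Definition top : bitseq := bits 11 [:: 3;4;5;6].
Definition bad_tops : seq bitseq := [:: bits 11 [:: 4;6;7;9]; bits 11 [:: 5;6;8;10]].

Definition orbit4 (ex : seq bitseq) : seq bitseq :=
  [seq t <- traces_of (core 4) | has (fun f => restrict f t \in ex) core4_auts].

Definition core4_without (ex : seq bitseq) : pattern :=
  let o := orbit4 ex in (core 4, fun t => t \in o).

Definition no_core (n : nat) : pattern := (core n, fun=> true).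

Definition trace_certs : seq cert := [::
(Node [::] (Pair 6 11) (Node [::] (Weigh [:: 1;1;1;1;1;1;1;0;1;1;1;1;1]) (Node [::] (Weigh [::
1;1;1;1;1;1;1;1;1;0;0;1;1;1]) Done Done) (Node [::] (Weigh [:: 1;1;1;1;1;1;1;0;1;1;1;1;1]) Done
(Node [::] (Weigh [:: 1;1;1;1;1;1;1;1;1;1;0;1;1]) Done (Node [::] (Weigh [::
1;1;1;1;1;1;1;0;1;1;1;1;1]) Done (Node [::] (Weigh [:: 1;1;1;1;1;1;1;0;1;1;1;1;1]) Done (Node [::]
(Weigh [:: 1;1;1;1;1;1;1;1;1;1;0;1;1]) Done (Node [::] (Weigh [:: 1;1;1;1;1;1;1;1;1;1;0;1;1]) Done
(Node [::] (Weigh [:: 1;1;1;1;1;1;1;1;1;1;0;1;1]) Done Done)))))))) Done);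
(Node [::] (Pair 10 11) (Node [::] (Weigh [:: 1;1;1;1;1;1;0;1;1;1;1;1;1]) (Node [:: (0,[::
0;13;3;1;10;4;7;5;9;2;6])] (Weigh [:: 1;1;1;1;0;1;1;1;0;1;1;1;1;1]) Done Done) (Node [::] (Weigh
[:: 1;1;1;1;0;1;1;1;1;1;1;1;1]) Done (Node [::] (Weigh [:: 1;1;1;1;1;1;1;0;1;1;1;1;1]) Done (Node
[::] (Weigh [:: 1;1;1;1;1;1;0;1;1;1;1;1;1]) (Node [:: (0,[:: 0;13;3;1;10;4;7;5;9;2;6])] (Weigh [::
1;1;1;1;0;1;1;1;0;1;1;1;1;1]) Done Done) (Node [::] (Weigh [:: 1;1;1;1;0;1;1;1;1;1;1;1;1]) Done
(Node [::] (Weigh [:: 1;1;1;1;1;1;0;1;1;1;1;1;1]) Done (Node [::] (Weigh [::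
1;1;1;1;1;1;0;1;1;1;1;1;1]) Done Done))))))) Done);
(Node [::] (Pair 10 11) (Node [::] (Weigh [:: 1;1;1;1;0;1;1;1;1;1;1;1;1]) (Node [:: (0,[::
0;13;2;3;4;5;6;7;8;9;10])] (Weigh [:: 1;0;1;1;1;1;0;1;1;1;1;1;1;1]) Done Done) (Node [::] (Weigh
[:: 1;1;1;1;0;1;1;1;1;1;1;1;1]) Done (Node [::] (Weigh [:: 1;1;1;1;1;1;0;1;1;1;1;1;1]) (Node [::
(0,[:: 0;13;3;1;10;4;7;5;9;2;6])] (Weigh [:: 1;1;1;1;0;1;1;1;0;1;1;1;1;1]) Done Done) (Node [::]
(Weigh [:: 1;1;1;1;0;1;1;1;1;1;1;1;1]) Done (Node [::] (Weigh [:: 1;1;1;1;1;1;0;1;1;1;1;1;1]) Done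
(Node [::] (Weigh [:: 1;1;1;1;1;1;0;1;1;1;1;1;1]) Done Done)))))) Done);
(Node [::] (Weigh [:: 1;1;1;2;1;1;0;1;1;1;1;1]) (Leaf 0 [:: 0;12;8;1;4;10;7;6;2;9;5] 11 (Leaf 0
[:: 0;8;3;1;12;4;7;5;9;2;6] 11 (Leaf 0 [:: 0;9;3;2;12;5;10;4;8;1;6] 11 Done))) Done);
(Node [::] (Weigh [:: 1;1;1;2;1;1;0;1;1;1;1;1]) (Leaf 0 [:: 12;4;5;0;1;2;11;7;8;9;10] 3 (Leaf 0
[:: 0;8;3;1;12;4;7;5;9;2;6] 11 (Leaf 0 [:: 0;9;3;2;12;5;10;4;8;1;6] 11 Done))) Done);
(Node [::] (Pair 7 11) (Node [::] (Weigh [:: 1;1;1;1;1;0;1;1;1;1;1;1;1]) (Node [:: (0,[::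
0;13;1;3;5;4;6;10;9;8;7])] (Weigh [:: 1;1;0;0;0;1;1;1;0;1;0;1;1;1]) (Leaf 0 [::
1;14;0;7;6;11;5;3;13;4;8] 9 (Leaf 0 [:: 0;2;1;3;14;4;6;10;9;8;7] 12 Done)) Done) (Node [::] (Weigh
[:: 1;1;1;1;1;0;1;1;1;1;1;1;1]) (Node [:: (0,[:: 0;13;1;3;5;4;6;10;9;8;7])] (Weigh [::
1;1;0;0;0;1;1;1;0;1;0;1;1;1]) (Leaf 0 [:: 1;14;0;7;6;11;5;3;13;4;8] 9 (Leaf 0 [::
0;2;1;3;14;4;6;10;9;8;7] 12 Done)) Done) (Node [::] (Weigh [:: 1;1;1;1;1;0;1;1;1;1;1;1;1]) Done
(Node [::] (Weigh [:: 1;1;1;1;1;1;0;1;1;1;1;1;1]) (Node [:: (0,[:: 0;13;3;2;7;5;10;4;8;1;6])]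
(Weigh [:: 1;1;1;1;1;1;0;1;0;0;0;1;1;0]) (Leaf 0 [:: 3;9;4;8;14;10;2;1;5;0;7] 12 (Leaf 0 [::
1;14;4;2;8;5;11;3;7;0;6] 9 Done)) (Leaf 0 [:: 1;13;4;2;8;5;11;3;7;0;6] 9 Done)) (Node [::] (Weigh
[:: 1;1;0;0;0;0;1;1;1;1;1;1;1]) (Leaf 0 [:: 8;3;6;2;13;7;1;9;10;0;4] 11 (Leaf 0 [::
1;2;0;4;13;3;6;11;12;7;8] 9 Done)) (Leaf 0 [:: 1;12;4;2;8;5;11;3;7;0;6] 9 Done)))))) Done);
(Node [::] (Pair 10 11) (Node [::] (Weigh [:: 1;1;1;1;1;1;0;1;1;1;1;1;1]) (Leaf 0 [::
13;1;2;3;4;5;11;7;8;9;10] 0 (Leaf 0 [:: 0;13;3;1;10;4;7;5;9;2;6] 12 Done)) (Node [::] (Weigh [::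
1;1;1;1;1;1;0;1;1;1;1;1;1]) (Leaf 0 [:: 13;1;2;3;4;5;11;7;8;9;10] 0 Done) (Node [::] (Weigh [::
1;1;1;1;1;1;0;1;1;1;1;1;1]) (Leaf 0 [:: 13;1;2;3;4;5;11;7;8;9;10] 0 (Node [:: (0,[::
0;13;3;1;10;4;7;5;9;2;6])] (Weigh [:: 1;1;1;1;1;1;0;0;0;0;1;1;1;0]) (Leaf 0 [::
13;14;3;10;1;4;7;12;11;2;9] 8 (Leaf 0 [:: 3;9;4;8;14;10;2;1;5;0;7] 11 (Leaf 0 [::
0;9;1;8;14;10;5;4;2;3;7] 12 Done))) Done)) (Node [::] (Weigh [:: 1;0;1;1;1;0;0;1;1;0;1;1;1]) (Leaf
0 [:: 13;1;2;3;4;5;11;7;8;9;10] 0 (Node [:: (0,[:: 0;9;3;2;13;5;10;4;8;1;6])] (Pair 7 11) (Node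
[::] (Weigh [:: 1;1;1;1;1;1;0;1;1;1;1;1;0;0;1]) (Leaf 0 [:: 0;15;3;2;7;5;10;4;8;1;6] 14 Done)
(Node [::] (Weigh [:: 1;1;1;1;1;1;0;1;1;1;1;1;0;0;1]) Done (Node [::] (Weigh [::
1;1;1;1;1;0;1;1;1;0;1;1;1;0;1]) (Leaf 0 [:: 0;9;1;8;15;10;5;4;2;3;7] 14 Done) (Node [::] (Weigh
[:: 1;1;1;1;0;1;1;1;0;1;1;1;1;0;1]) (Leaf 0 [:: 2;8;0;13;15;9;4;11;12;10;3] 14 Done) (Leaf 0 [::
9;3;6;1;14;10;2;8;7;0;5] 12 Done))))) Done)) (Node [:: (0,[:: 8;3;6;2;12;7;1;9;10;0;4])] (Weigh
[:: 1;0;1;1;1;0;0;1;1;0;1;1;1]) (Leaf 0 [:: 13;1;2;3;4;5;11;7;8;9;10] 0 (Node [:: (0,[::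
2;13;10;0;9;11;3;4;8;12;6]); (0,[:: 0;9;3;2;13;5;10;4;8;1;6]); (0,[:: 8;2;0;6;13;9;4;1;3;10;12])]
(Pair 7 11) (Node [::] (Weigh [:: 1;0;1;1;0;0;1;1;1;1;1;1;1;1;1]) (Leaf 0 [::
2;15;13;0;11;9;3;6;12;8;4] 14 Done) Done) Done)) (Leaf 0 [:: 12;1;2;3;4;5;11;7;8;9;10] 0
Done)))))) Done);
(Node [::] (Weigh [:: 2;1;1;1;1;1;0;1;1;1;1;1]) (Node [:: (0,[:: 12;1;2;3;4;5;6;7;8;9;10])] (Weigh
[:: 0;1;1;1;1;0;0;0;1;1;1;1;1]) (Leaf 0 [:: 12;13;1;3;5;4;11;10;9;8;7] 0 (Leaf 0 [::
0;13;1;3;5;4;6;10;9;8;7] 11 (Leaf 0 [:: 12;13;3;2;7;11;10;4;8;1;6] 0 (Leaf 0 [::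
0;13;3;2;7;5;10;4;8;1;6] 11 Done)))) (Leaf 0 [:: 0;12;3;2;7;5;10;4;8;1;6] 11 (Leaf 0 [::
2;8;5;1;12;4;9;3;7;0;6] 11 (Leaf 0 [:: 0;8;3;1;12;4;7;5;9;2;6] 11 (Node [:: (0,[::
0;9;3;2;12;5;10;4;8;1;6])] (Weigh [:: 1;1;1;0;1;0;1;0;1;1;1;1;0]) (Leaf 0 [::
8;3;6;2;13;12;1;9;10;0;4] 11 (Node [::] (Weigh [:: 1;1;1;1;1;0;1;0;1;1;1;1;1;1]) (Leaf 0 [::
0;14;1;3;5;4;6;10;9;8;7] 11 (Node [:: (0,[:: 0;14;8;1;4;10;12;6;13;9;5])] (Weigh [::
1;1;0;1;0;0;1;1;1;1;1;0;0;1;0]) (Leaf 0 [:: 0;15;8;1;4;10;7;6;13;9;5] 11 (Leaf 0 [::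
0;15;8;1;4;10;7;6;13;9;5] 11 (Leaf 0 [:: 0;15;8;1;4;10;7;6;13;9;5] 11 (Leaf 0 [::
9;15;6;0;2;8;13;10;3;1;5] 11 Done)))) (Leaf 0 [:: 0;14;8;1;4;10;7;6;13;9;5] 11 Done))) (Leaf 0 [::
9;3;6;1;13;10;2;8;7;0;5] 11 (Leaf 0 [:: 0;13;1;3;5;4;6;10;9;8;7] 11 (Node [::] (Weigh [::
1;1;0;0;0;0;1;0;0;0;1;1;0;1]) (Leaf 0 [:: 8;3;6;2;14;7;1;13;10;0;4] 11 (Leaf 0 [::
0;2;1;3;14;4;6;10;13;8;7] 11 (Leaf 0 [:: 0;2;1;3;14;4;6;10;13;8;7] 11 Done))) (Leaf 0 [::
0;13;3;2;7;5;10;4;8;1;6] 11 (Leaf 0 [:: 0;1;2;3;13;5;6;7;8;9;10] 11 Done))))))) (Leaf 0 [::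
0;1;2;3;12;5;6;7;8;9;10] 11 Done)))))) Done);
(Node [::] (Pair 9 11) (Node [::] (Weigh [:: 1;1;1;1;1;1;1;1;1;1;0;1;1]) (Leaf 0 [::
0;13;2;3;4;5;6;7;8;9;10] 11 Done) (Node [::] (Weigh [:: 1;1;1;1;1;0;1;1;1;1;1;1;1]) (Leaf 0 [::
0;13;8;1;4;10;7;6;2;9;5] 11 Done) (Node [::] (Weigh [:: 1;1;1;1;0;0;1;1;1;1;0;0;1]) (Leaf 0 [::
0;13;2;3;4;12;6;7;8;9;10] 11 (Leaf 0 [:: 0;13;2;3;4;12;6;7;8;9;10] 11 (Leaf 0 [::
0;13;8;1;4;12;7;6;2;9;5] 11 (Leaf 0 [:: 0;13;8;1;4;12;7;6;2;9;5] 11 Done)))) (Leaf 0 [::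
0;8;3;1;12;4;7;5;9;2;6] 11 (Leaf 0 [:: 0;2;1;3;12;4;6;10;9;8;7] 11 Done))))) Done);
(Node [::] (Pair 3 11) (Node [::] (Weigh [:: 1;1;0;1;1;0;1;0;1;0;1;1;1]) (Leaf 0 [::
1;9;4;2;13;5;8;3;10;0;6] 12 (Leaf 0 [:: 0;9;3;2;13;5;10;4;8;1;6] 11 Done)) (Node [::] (Weigh [::
1;1;1;1;1;1;0;0;1;1;0;0;1]) (Leaf 0 [:: 0;13;3;2;7;5;12;4;8;1;6] 11 (Leaf 0 [::
0;13;3;2;7;5;12;4;8;1;6] 11 (Leaf 0 [:: 0;13;3;1;10;4;12;5;9;2;6] 11 (Leaf 0 [::
0;13;3;1;10;4;12;5;9;2;6] 11 Done)))) (Leaf 0 [:: 0;8;3;1;12;4;7;5;9;2;6] 11 (Leaf 0 [::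
0;9;3;2;12;5;10;4;8;1;6] 11 Done)))) Done);
(Node [::] (Weigh [:: 2;1;1;1;1;0;1;1;1;1;1;1]) (Leaf 0 [:: 9;3;6;1;12;10;2;8;7;0;5] 11 (Node [::
(0,[:: 12;1;2;3;4;5;6;7;8;9;10])] (Pair 0 11) (Node [::] (Weigh [:: 1;1;1;1;1;1;0;0;1;1;1;1;1;1])
(Leaf 0 [:: 12;14;3;2;7;5;10;4;8;1;6] 13 (Leaf 0 [:: 0;14;3;2;7;5;10;4;8;1;6] 11 Done)) Done)
(Leaf 0 [:: 0;12;1;3;5;4;6;10;9;8;7] 11 (Leaf 0 [:: 1;9;4;2;12;5;8;3;10;0;6] 11 (Leaf 0 [::
0;12;3;1;10;4;7;5;9;2;6] 11 (Leaf 0 [:: 0;12;8;1;4;10;7;6;2;9;5] 11 (Leaf 0 [::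
0;8;3;1;12;4;7;5;9;2;6] 11 (Leaf 0 [:: 0;9;3;2;12;5;10;4;8;1;6] 11 (Leaf 0 [::
0;1;2;3;12;5;6;7;8;9;10] 11 (Leaf 0 [:: 0;2;1;3;12;4;6;10;9;8;7] 11 (Leaf 0 [::
0;9;1;8;12;10;5;4;2;3;7] 11 Done))))))))))) Done);
(Node [::] (Pair 5 11) (Node [::] (Weigh [:: 1;1;1;1;1;1;1;0;1;1;1;1;1]) (Node [:: (0,[::
0;13;1;3;5;4;6;10;9;8;7])] (Pair 10 12) (Node [::] (Weigh [:: 1;1;0;1;1;1;0;0;0;0;1;0;1;1;1])
(Leaf 0 [:: 3;9;4;8;15;10;2;1;5;0;7] 12 (Leaf 0 [:: 1;9;4;2;15;5;8;3;10;0;6] 11 Done)) (Leaf 0 [::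
1;9;4;2;14;5;8;3;10;0;6] 11 (Leaf 0 [:: 0;14;8;1;4;10;7;6;2;9;5] 11 Done))) (Node [:: (0,[::
0;13;3;2;7;5;10;4;8;1;6])] (Pair 4 11) (Node [::] (Weigh [:: 1;1;0;1;1;1;0;0;0;0;1;1;0;1;1]) (Leaf
0 [:: 1;9;4;2;15;5;8;3;10;0;6] 11 (Leaf 0 [:: 1;15;4;0;8;3;14;5;13;2;6] 12 (Leaf 0 [::
13;1;0;6;15;8;5;11;14;4;2] 9 (Leaf 0 [:: 1;15;4;0;8;3;14;5;9;2;6] 11 (Leaf 0 [::
1;15;4;0;8;3;14;5;9;2;6] 11 Done))))) (Leaf 0 [:: 1;9;4;2;14;5;8;3;10;0;6] 11 (Leaf 0 [::
0;14;3;1;10;4;7;5;9;2;6] 12 Done))) Done)) (Node [::] (Pair 2 12) (Node [::] (Weigh [::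
1;0;1;0;0;0;1;1;1;1;1;0;1;1]) (Leaf 0 [:: 2;14;7;8;3;6;13;9;10;0;4] 11 (Leaf 0 [::
9;3;6;1;14;10;2;8;7;0;5] 11 Done)) (Node [::] (Weigh [:: 1;1;1;1;1;1;1;0;1;1;1;1;1;0]) (Node [::
(0,[:: 0;14;1;3;5;4;6;10;12;8;7])] (Weigh [:: 1;1;1;1;0;1;1;1;1;1;0;0;1;1;1]) (Leaf 0 [::
0;15;2;3;4;5;13;7;8;9;10] 11 Done) (Node [:: (0,[:: 0;14;3;2;7;5;10;4;8;1;6])] (Weigh [::
1;1;1;1;0;1;1;1;1;0;0;1;1;1;1]) (Leaf 0 [:: 0;15;2;3;4;5;13;7;8;9;10] 11 Done) Done)) (Leaf 0 [::
0;9;1;8;13;10;5;4;2;3;7] 11 Done))) (Node [::] (Pair 8 12) (Node [::] (Weigh [::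
1;0;0;0;1;1;0;0;1;0;0;0;1;1]) (Leaf 0 [:: 8;2;0;6;14;9;4;13;12;5;1] 11 (Leaf 0 [::
2;14;5;0;9;3;12;4;8;1;6] 11 Done)) (Node [::] (Weigh [:: 1;1;1;1;0;1;1;1;1;0;0;1;2;1]) (Leaf 0 [::
8;5;6;0;14;9;1;13;12;2;4] 11 (Leaf 0 [:: 2;8;5;1;14;4;9;3;7;0;6] 11 (Leaf 0 [::
2;0;1;5;14;4;6;12;13;8;9] 11 (Leaf 0 [:: 2;0;1;5;14;4;6;12;13;8;9] 11 (Leaf 0 [::
2;14;5;0;9;3;12;4;8;1;6] 11 Done))))) (Leaf 0 [:: 2;13;5;0;9;3;12;4;8;1;6] 11 Done))) (Node [::]
(Pair 10 12) (Node [::] (Weigh [:: 1;1;1;0;1;0;1;0;1;0;1;0;1;1]) (Leaf 0 [::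
1;9;4;2;14;5;8;3;10;0;6] 11 (Leaf 0 [:: 1;14;10;0;3;8;13;6;2;9;5] 11 (Leaf 0 [::
2;1;0;5;14;3;6;12;13;10;9] 11 Done))) (Leaf 0 [:: 1;9;4;2;13;5;8;3;10;0;6] 11 Done)) (Node [::
(0,[:: 0;12;3;2;7;5;10;4;8;1;6])] (Pair 4 11) (Node [::] (Weigh [:: 1;1;0;1;1;1;0;0;0;0;1;1;1;1])
(Leaf 0 [:: 1;9;4;2;14;5;8;3;10;0;6] 11 (Leaf 0 [:: 12;1;0;6;14;8;5;11;13;4;2] 9 (Leaf 0 [::
1;14;4;0;8;3;13;5;9;2;6] 11 Done))) (Leaf 0 [:: 1;9;4;2;13;5;8;3;10;0;6] 11 (Node [:: (0,[::
0;13;3;1;10;4;7;5;9;2;6])] (Weigh [:: 1;1;0;0;1;0;1;0;1;0;1;1;1;1]) (Leaf 0 [::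
8;3;6;2;14;7;1;9;10;0;4] 11 (Leaf 0 [:: 1;9;4;2;14;5;8;3;10;0;6] 11 Done)) Done))) (Leaf 0 [::
2;8;5;1;12;4;9;3;7;0;6] 11 Done)))))) Done);
(Node [::] (Pair 9 11) (Node [::] (Pair 1 12) (Node [::] (Weigh [:: 1;1;0;0;0;1;0;1;0;0;0;0;1;1])
(Leaf 0 [:: 1;9;0;10;14;8;5;13;12;7;3] 11 (Leaf 0 [:: 1;9;0;10;14;8;5;13;12;7;3] 11 Done)) (Node
[::] (Weigh [:: 1;1;1;1;0;1;0;1;0;1;0;0;1;1]) (Leaf 0 [:: 2;8;5;1;14;4;9;3;7;0;6] 11 (Leaf 0 [::
2;8;5;1;14;4;9;3;7;0;6] 11 (Leaf 0 [:: 9;14;7;0;8;2;12;5;1;3;10] 11 Done))) (Leaf 0 [::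
9;13;7;0;8;2;12;5;1;3;10] 11 Done))) (Node [::] (Pair 3 12) (Node [::] (Weigh [::
1;0;0;1;0;0;1;0;0;0;1;0;1;1]) (Leaf 0 [:: 3;9;0;5;14;2;10;13;12;6;1] 11 (Leaf 0 [::
3;9;0;5;14;2;10;13;12;6;1] 11 Done)) (Node [::] (Weigh [:: 1;1;0;1;0;0;1;0;1;1;1;0;1;1]) (Leaf 0
[:: 8;3;6;2;14;7;1;9;10;0;4] 11 (Leaf 0 [:: 8;3;6;2;14;7;1;9;10;0;4] 11 (Leaf 0 [::
9;14;6;0;2;8;12;10;3;1;5] 11 Done))) (Leaf 0 [:: 9;13;6;0;2;8;12;10;3;1;5] 11 Done))) (Leaf 0 [::
9;3;6;1;12;10;2;8;7;0;5] 11 (Node [::] (Pair 4 12) (Node [::] (Weigh [::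
1;0;1;1;1;1;0;1;0;1;0;0;1;1]) (Leaf 0 [:: 2;8;5;1;14;4;9;3;7;0;6] 11 (Leaf 0 [::
1;14;4;0;8;3;13;5;9;2;6] 11 Done)) (Leaf 0 [:: 1;9;4;2;13;5;8;3;10;0;6] 11 Done)) (Node [::] (Pair
6 12) (Node [::] (Weigh [:: 1;0;0;1;0;0;1;1;0;0;0;0;1;1]) (Leaf 0 [:: 3;8;0;4;14;1;7;12;13;6;2] 11
(Leaf 0 [:: 3;8;0;4;14;1;7;12;13;6;2] 11 Done)) (Leaf 0 [:: 3;13;0;6;7;12;10;1;8;4;2] 11 Done))
(Node [:: (0,[:: 0;12;1;3;5;4;6;10;9;8;7])] (Pair 2 11) (Node [:: (0,[::
0;13;3;2;7;5;10;4;8;1;6])] (Weigh [:: 1;1;1;1;0;1;1;1;1;1;0;1;1;1]) (Node [:: (0,[::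
3;0;8;4;14;10;7;12;11;13;2]); (0,[:: 8;0;3;10;14;4;7;13;11;12;9]); (0,[::
0;14;12;3;4;5;11;7;8;9;10]); (0,[:: 0;14;2;3;4;11;6;7;8;13;10])] (Pair 1 11) Done Done) (Node [::
(0,[:: 0;13;8;1;4;10;7;6;2;9;5])] (Weigh [:: 1;1;1;1;1;1;0;1;1;1;0;1;1;1]) (Node [:: (0,[::
1;0;9;10;14;6;5;13;11;12;3]); (0,[:: 9;0;1;6;14;10;5;12;11;13;2]); (0,[::
0;14;13;1;10;4;11;5;9;2;6]); (0,[:: 0;14;3;1;10;11;7;5;9;12;6])] (Pair 8 11) Done Done) Done))
(Node [::] (Pair 4 12) (Node [::] (Weigh [:: 1;0;0;0;1;0;0;0;0;1;1;0;1;1]) (Leaf 0 [::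
9;3;0;7;14;2;10;12;13;4;8] 11 (Leaf 0 [:: 3;14;4;0;2;1;13;10;9;8;7] 11 Done)) (Leaf 0 [::
3;9;4;8;13;10;2;1;5;0;7] 11 Done)) (Node [::] (Pair 7 12) (Node [::] (Weigh [::
1;1;0;0;0;0;1;1;0;0;0;0;1;1]) (Leaf 0 [:: 1;2;0;4;14;3;6;12;13;7;8] 11 (Leaf 0 [::
1;2;0;4;14;3;6;12;13;7;8] 11 Done)) (Leaf 0 [:: 1;13;4;2;8;5;12;3;7;0;6] 11 Done)) (Node [::
(0,[:: 0;12;3;1;10;4;7;5;9;2;6])] (Pair 8 11) (Node [:: (0,[:: 0;13;2;3;4;5;6;7;8;9;10])] (Weigh
[:: 1;1;1;1;1;0;1;0;1;1;1;1;1;1]) (Node [:: (0,[:: 3;0;9;5;14;7;10;13;11;12;1]); (0,[::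
9;0;3;7;14;5;10;12;11;13;8]); (0,[:: 0;14;13;3;5;4;11;10;9;8;7]); (0,[::
0;14;1;3;5;11;6;10;9;12;7])] (Pair 2 11) Done Done) (Node [:: (0,[:: 0;13;3;2;7;5;10;4;8;1;6])]
(Weigh [:: 1;1;1;1;0;0;1;1;1;1;1;1;1;1]) (Node [:: (0,[:: 1;0;2;4;14;5;6;12;11;13;8]); (0,[::
2;0;1;5;14;4;6;13;11;12;9]); (0,[:: 0;14;12;1;4;10;11;6;2;9;5]); (0,[::
0;14;8;1;4;11;7;6;2;13;5])] (Pair 3 11) Done Done) Done)) Done))))))))) Done)].

Definition hexagon_cert : cert :=
(Node [::] (Pair 1 4) (Node [::] (Pair 0 3) (Node [::] (Pair 2 5) (Node [::] (Weigh [::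
1;1;1;1;1;1;0;1;1;1]) (Node [::] (Weigh [:: 1;1;0;1;1;0;0;1;1;0;0]) (Leaf 0 [::
1;10;4;2;11;5;7;3;8;0;6] 0 (Leaf 0 [:: 1;10;4;2;11;5;7;3;8;0;6] 0 (Leaf 0 [::
0;10;3;2;11;5;8;4;7;1;6] 0 (Leaf 0 [:: 0;10;3;2;11;5;8;4;7;1;6] 0 Done)))) (Node [::] (Weigh [::
1;0;1;1;0;1;0;0;1;1;0]) (Leaf 0 [:: 2;10;5;1;11;4;9;3;8;0;6] 0 (Leaf 0 [::
1;11;4;2;10;5;7;3;8;0;6] 0 (Leaf 0 [:: 0;10;3;1;11;4;8;5;9;2;6] 0 (Leaf 0 [::
0;10;3;1;11;4;8;5;9;2;6] 0 Done)))) (Node [::] (Weigh [:: 0;1;1;0;1;1;0;1;0;1;0]) (Leaf 0 [::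
2;10;5;0;11;3;9;4;7;1;6] 0 (Leaf 0 [:: 0;11;3;2;10;5;8;4;7;1;6] 0 (Leaf 0 [::
1;10;4;0;11;3;7;5;9;2;6] 0 (Leaf 0 [:: 0;11;3;1;10;4;8;5;9;2;6] 0 Done)))) Done))) (Node [::]
(Weigh [:: 1;1;1;1;1;1;0;1;1;1]) (Node [::] (Weigh [:: 1;1;0;1;1;0;0;1;1;0;0]) (Leaf 0 [::
1;10;4;2;11;5;7;3;8;0;6] 0 (Leaf 0 [:: 0;10;3;2;11;5;8;4;7;1;6] 0 (Leaf 0 [::
0;10;3;2;11;5;8;4;7;1;6] 0 Done))) (Node [::] (Weigh [:: 0;1;1;0;1;1;0;1;0;1;0]) (Leaf 0 [::
2;10;5;0;11;3;9;4;7;1;6] 0 (Leaf 0 [:: 0;11;3;2;10;5;8;4;7;1;6] 0 (Leaf 0 [::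
1;10;4;0;11;3;7;5;9;2;6] 0 Done))) Done)) (Node [::] (Weigh [:: 1;1;1;1;1;1;0;1;1;1]) (Node [::]
(Weigh [:: 1;1;0;1;1;0;0;1;1;0;0]) (Leaf 0 [:: 1;10;4;2;11;5;7;3;8;0;6] 0 (Leaf 0 [::
1;10;4;2;11;5;7;3;8;0;6] 0 (Leaf 0 [:: 0;10;3;2;11;5;8;4;7;1;6] 0 Done))) (Node [::] (Weigh [::
1;0;1;1;0;1;0;0;1;1;0]) (Leaf 0 [:: 2;10;5;1;11;4;9;3;8;0;6] 0 (Leaf 0 [::
1;11;4;2;10;5;7;3;8;0;6] 0 (Leaf 0 [:: 0;10;3;1;11;4;8;5;9;2;6] 0 Done))) Done)) (Node [::] (Weigh
[:: 1;1;0;1;1;0;0;1;1;0]) (Leaf 0 [:: 1;9;4;2;10;5;7;3;8;0;6] 0 (Leaf 0 [::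
0;9;3;2;10;5;8;4;7;1;6] 0 Done)) Done)))) (Node [::] (Pair 2 5) (Node [::] (Weigh [::
1;1;1;1;1;1;0;1;1;1]) (Node [::] (Weigh [:: 1;0;1;1;0;1;0;0;1;1;0]) (Leaf 0 [::
2;10;5;1;11;4;9;3;8;0;6] 0 (Leaf 0 [:: 0;10;3;1;11;4;8;5;9;2;6] 0 (Leaf 0 [::
0;10;3;1;11;4;8;5;9;2;6] 0 Done))) (Node [::] (Weigh [:: 0;1;1;0;1;1;0;1;0;1;0]) (Leaf 0 [::
2;10;5;0;11;3;9;4;7;1;6] 0 (Leaf 0 [:: 1;10;4;0;11;3;7;5;9;2;6] 0 (Leaf 0 [::
0;11;3;1;10;4;8;5;9;2;6] 0 Done))) Done)) (Node [::] (Weigh [:: 0;1;1;0;1;1;0;1;0;1]) (Leaf 0 [::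
2;8;5;0;10;3;9;4;7;1;6] 0 (Leaf 0 [:: 1;8;4;0;10;3;7;5;9;2;6] 0 Done)) (Node [::] (Weigh [::
1;0;1;1;0;1;0;0;1;1]) (Leaf 0 [:: 2;7;5;1;10;4;9;3;8;0;6] 0 (Leaf 0 [:: 0;7;3;1;10;4;8;5;9;2;6] 0
Done)) Done))) Done)) Done) Done).

Definition deficient_certs : seq cert := [::
(Node [::] (Weigh [:: 1;1;1;1;1;0;0;0;1;1;1;1]) (Node [:: (0,[:: 0;12;1;3;5;4;11;10;9;8;7])] (Pair
6 12) (Node [::] (Weigh [:: 1;0;0;1;0;0;1;1;0;0;0;0;1;1]) (Leaf 0 [:: 0;8;3;1;14;4;7;5;13;12;11] 2
(Leaf 0 [:: 0;8;3;1;14;4;7;5;13;12;11] 2 Done)) (Leaf 0 [:: 0;13;1;8;11;10;5;4;12;3;7] 2 Done))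
(Node [:: (0,[:: 0;12;1;3;5;4;11;10;9;8;7]); (0,[:: 0;12;1;3;5;4;6;10;9;8;7])] (Pair 2 11) (Leaf 1
[:: 0;3;8;1;4;10;7;6;2;13;11;12;9] 0 Done) (Node [:: (0,[:: 0;12;3;2;7;11;10;4;8;1;6])] (Pair 9
11) (Node [::] (Weigh [:: 1;0;0;0;0;0;0;1;1;1;0;1;0;1]) (Leaf 0 [:: 0;3;8;1;14;10;7;6;13;9;5] 12
(Leaf 0 [:: 0;3;8;1;14;10;7;6;13;9;5] 12 Done)) (Leaf 0 [:: 0;13;1;3;5;4;6;10;9;8;7] 12 Done))
(Node [:: (0,[:: 0;12;3;2;7;11;10;4;8;1;6]); (0,[:: 0;12;3;2;7;5;10;4;8;1;6])] (Pair 9 11) (Leaf 1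
[:: 0;8;3;1;10;4;7;5;9;13;11;12;2] 0 Done) Done)))) Done);
(Node [::] (Pair 10 11) (Node [::] (Weigh [:: 1;1;1;1;1;1;0;0;0;0;1;1;1]) (Leaf 0 [::
3;9;4;8;13;10;2;1;5;0;7] 11 (Leaf 1 [:: 0;8;2;9;13;7;4;5;1;3;10;12;11] 0 Done)) (Leaf 1 [::
2;8;0;7;6;9;4;11;12;10;3;1;5] 0 Done)) Done);
(Node [::] (Pair 9 11) (Node [::] (Weigh [:: 1;1;0;1;1;1;0;0;0;1;1;1;1]) (Leaf 1 [::
9;3;0;7;5;2;10;12;13;4;8;1;6] 0 (Leaf 1 [:: 0;3;9;2;13;7;10;6;1;8;4;11;12] 0 Done)) (Node [::]
(Weigh [:: 1;1;0;1;1;0;0;0;1;1;1;1;1]) (Node [:: (0,[:: 1;9;4;2;13;5;8;3;10;0;6])] (Weigh [::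
0;0;0;1;0;0;0;1;1;1;0;1;1;0]) (Leaf 0 [:: 9;4;7;13;14;2;8;12;11;3;10] 5 Done) (Node [:: (0,[::
3;13;4;0;2;1;11;10;9;8;7]); (0,[:: 0;2;1;3;13;4;6;10;9;8;7])] (Pair 5 11) (Leaf 0 [::
0;14;3;2;7;5;10;4;8;1;6] 12 Done) Done)) (Node [:: (0,[:: 3;12;4;0;2;1;11;10;9;8;7]); (0,[::
0;2;1;3;12;4;6;10;9;8;7])] (Pair 5 11) (Leaf 1 [:: 0;8;3;1;10;4;7;5;13;11;12;9;2] 0 Done) Done)))
Done)].

Definition two_tops_cert : cert :=
(Leaf 1 [:: 8;0;3;10;1;4;7;12;6;2;9;5;11] 0 (Leaf 1 [:: 9;0;3;7;2;5;10;12;6;1;8;4;11] 0 Done)).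

Definition core6_degree_cert : cert :=
(Node [:: (0,[:: 10;4;6;2;13;11;0;9;8;1;3]); (0,[:: 8;3;6;2;13;7;1;9;10;0;4])] (Weigh [::
1;0;1;1;0;0;1;1;1;0;1;0;1;1]) Done (Node [:: (0,[:: 9;4;6;0;13;8;2;10;11;1;5]); (0,[::
11;5;6;0;13;12;1;10;9;2;4])] (Weigh [:: 1;0;1;0;0;1;1;1;0;1;0;1;1;1]) Done (Node [::] (Pair 5 13)
(Node [:: (0,[:: 10;14;8;4;9;3;13;0;5;1;11]); (0,[:: 5;11;3;10;14;12;1;0;4;2;9]); (0,[::
8;14;10;3;9;4;13;1;5;0;7]); (0,[:: 3;9;4;8;14;10;2;1;5;0;7]); (0,[:: 4;9;3;10;14;8;2;0;5;1;11])]
(Weigh [:: 2;1;1;1;0;1;1;1;1;0;1;0;1;1;0]) Done Done) (Node [::] (Pair 4 13) (Leaf 0 [::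
3;9;4;8;14;10;2;1;5;0;7] 13 Done) (Node [::] (Pair 4 13) (Leaf 0 [:: 5;11;3;10;14;12;1;0;4;2;9] 13
Done) (Node [::] (Pair 3 13) (Node [:: (0,[:: 9;14;1;3;8;13;5;2;4;11;10]); (0,[::
3;9;4;8;14;10;2;1;5;0;7]); (0,[:: 11;14;2;3;12;13;4;1;5;9;10]); (0,[::
5;11;3;10;14;12;1;0;4;2;9]); (0,[:: 4;9;3;10;14;8;2;0;5;1;11])] (Weigh [::
1;1;1;1;0;0;1;1;1;1;0;0;0;1;0]) Done Done) Done)))))).

Definition core6_ends_cert : cert :=
(Node [:: (0,[:: 0;1;2;3;4;5;6;7;8;9;10]); (0,[:: 2;0;1;5;3;4;6;9;10;11;12]); (0,[::
1;0;2;4;3;5;6;11;10;9;8])] (Weigh [:: 1;0;1;1;0;1;0;1;0;0;0;0;1]) Done Done).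

Definition id4 : seq (nat * seq nat) := [:: (0, iota 0 11)].

Definition few (t : bitseq) : bool := count id (take 6 t) < 2.

(* Both vertices look like opposite hexagon vertices, the first one among a, b, c. *)
Definition opposite (t u : bitseq) : bool :=
  (take 6 t, take 6 u) \in
    [:: (bits 6 [:: 4;5], bits 6 [:: 1;2]); (bits 6 [:: 3;5], bits 6 [:: 0;2]);
        (bits 6 [:: 3;4], bits 6 [:: 0;1])].

Definition good_traces (tr : seq bitseq) : bool :=
  all (fun t => ~~ few t && all (fun u => disj t u ==> ~~ opposite t u) tr) tr.

Lemma trace_certs_ok :
  all (fun k => refute [:: core4_without (take k impossible)] (core 4)
      (prune [:: core4_without (take k impossible)] (core 4) id4 (traces_of (core 4)))
      (pred1 (nth [::] impossible k)) (nth Done trace_certs k)) (iota 0 13).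
Proof. by vm_cast_no_check (erefl true). Qed.

Lemma hexagon_cert_ok : refute_base [:: no_core 4] (core 0) (traces_of (core 0)) hexagon_cert.
Proof. by vm_cast_no_check (erefl true). Qed.

Lemma deficient_certs_ok :
  all (fun k => refute [:: core4_without impossible; no_core 6] (core 4)
      (prune [:: core4_without impossible] (core 4) id4 (traces_of (core 4)))
      (pred1 (nth [::] deficient k)) (nth Done deficient_certs k)) (iota 0 3).
Proof. by vm_cast_no_check (erefl true). Qed.

Lemma two_tops_cert_ok :
  refute [:: core4_without impossible; no_core 6] (add_row (core 4) top)
    (prune [:: core4_without impossible] (add_row (core 4) top)
       [:: (0, iota 0 11); (0, [:: 3; 0; 8; 4; 1; 10; 7; 11; 5; 9; 2])]
       (traces_of (add_row (core 4) top)))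
    (fun t => take 11 t \in bad_tops) two_tops_cert.
Proof. by vm_cast_no_check (erefl true). Qed.

Definition core6_copies : seq (nat * seq nat) :=
  [:: (0, iota 0 11); (0, [:: 2;0;1;5;3;4;6;9;10;11;12]); (0, [:: 1;0;2;4;3;5;6;11;10;9;8])].

Definition core6_traces : seq bitseq :=
  prune [:: core4_without impossible] (core 6) core6_copies (traces_of (core 6)).

Lemma core6_degree_cert_ok :
  refute [:: core4_without impossible] (core 6) core6_traces few core6_degree_cert.
Proof. by vm_cast_no_check (erefl true). Qed.

Lemma core6_good : good_traces [seq t <- core6_traces | ~~ few t].
Proof. by vm_cast_no_check (erefl true). Qed.

Definition ends_ok (t : bitseq) : bool :=
  [&& ~~ few t, ~~ [&& nth false t 2, nth false t 5 & nth false t 7]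
    & ~~ [&& nth false t 0, nth false t 3 & nth false t 12]].

Lemma core6_ends_cert_ok :
  refute_base [:: core4_without impossible] (core 6)
    [seq t <- traces_of (core 6) | ends_ok t] core6_ends_cert.
Proof. by vm_cast_no_check (erefl true). Qed.

Definition core4_traces : seq bitseq :=
  [seq t <- traces_of (core 4) | t \notin orbit4 (impossible ++ deficient)].

Lemma core4_good : good_traces [seq t <- core4_traces | t \notin bad_tops].
Proof. by vm_cast_no_check (erefl true). Qed.

Lemma core4_auts_ok : all (fun f => is_copy (core 4) (no_core 4) f) core4_auts.
Proof. by vm_cast_no_check (erefl true). Qed.

Lemma bad_tops_orbit : all (fun t => has (fun f => restrict f t == top) core4_auts) bad_tops.
Proof. by vm_cast_no_check (erefl true). Qed.

Arguments core : simpl never.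
Arguments refute : simpl never.
Arguments prune : simpl never.
Arguments core4_without : simpl never.
Arguments add_row : simpl never.

Section Local.
Variables (T : finType) (adj : rel T) (x0 : T).
Hypotheses (adj_sym : symmetric adj) (adj_irr : irreflexive adj).
Hypothesis tf : triangle_free adj.
Hypothesis common : forall x y, ~~ adj x y -> exists z, adj z x && adj z y.
Hypothesis Q4 : property_Q 4 adj.

Local Notation trace := (trace adj).
Local Notation gram := (gram adj).
Local Notation avoids := (avoids adj).

Let traces_all := traces_complete x0 tf.
Let refuteP := refute_sound x0 adj_sym adj_irr tf common Q4.
Let refute_baseP := refute_base_sound x0 adj_sym adj_irr tf common Q4.

Lemma avoids1 p : avoids p -> forall q, List.In q [:: p] -> avoids q.
Proof. by move=> av q [<-|[]]. Qed.

Lemma avoids2 p p' : avoids p -> avoids p' -> forall q, List.In q [:: p; p'] -> avoids q.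
Proof. by move=> av av' q [<-|[<-|[]]]. Qed.

Lemma take_trace k s g : take k (trace s g) = trace (take k s) g.
Proof. by rewrite /trace map_take. Qed.

Lemma gram_take k s : gram (take k s) = [seq take k r | r <- take k (gram s)].
Proof. by rewrite /gram -map_take -map_comp; apply: eq_map => x /=; rewrite take_trace. Qed.

Lemma core4_aut s f : gram s = core 4 -> f \in core4_auts ->
  gram [seq nth x0 s i | i <- f] = core 4 /\
  forall g, trace [seq nth x0 s i | i <- f] g = restrict f (trace s g).
Proof.
move=> gs /(allP core4_auts_ok); rewrite -{1}gs => cp.
have [lt_f gf] := is_copyP x0 cp; split=> [//|g].
by rewrite -(restrict_trace adj x0).
Qed.

Lemma avoids_orbit ex :
  (forall s, gram s = core 4 -> forall g, trace s g \notin ex) -> avoids (core4_without ex).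
Proof.
move=> ok s gs g; apply/negP; rewrite /= /orbit4 mem_filter => /andP[/hasP[f fin tin] _].
by have [gf tf'] := core4_aut gs fin; move: (ok _ gf g); rewrite tf' tin.
Qed.

Lemma prune_core4 ex s (gs : gram s = core 4) : avoids (core4_without ex) ->
  forall g, trace s g \in
    prune [:: core4_without ex] (core 4) id4 (traces_of (core 4)).
Proof.
move=> av g; rewrite -gs; apply: (prune_complete x0 _ (avoids1 av)) => h.
exact: traces_all.
Qed.

Lemma core4_impossible s g : gram s = core 4 -> trace s g \notin impossible.
Proof.
suff H k : k <= 13 -> forall s g, gram s = core 4 -> trace s g \notin take k impossible.
  by move=> gs; have := H 13 (leqnn _) s g gs.
elim: k => [|k IH] lt_k {s}s {g}g gs; first by rewrite take0.
have av := avoids_orbit (fun s gs g => IH (ltnW lt_k) s g gs).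
rewrite (take_nth [::]) // mem_rcons inE negb_or IH ?(ltnW lt_k) // andbT.
have /(allP trace_certs_ok) : k \in iota 0 13 by rewrite mem_iota.
rewrite -{1}gs => ok.
exact: (refuteP (avoids1 av) (prune_core4 gs av) ok g).
Qed.

Lemma avoids_impossible : avoids (core4_without impossible).
Proof. by apply: avoids_orbit => s gs g; apply: core4_impossible. Qed.

Lemma hexagon_core4 h : gram h = core 0 -> exists s, gram s = core 4.
Proof.
move=> gh; have [/existsP[s /eqP gs]|no4] := boolP [exists s : 11.-tuple T, gram s == core 4].
  by exists s.
have av : avoids (no_core 4).
  move=> s gs; have sz : size s == 11 by rewrite -(size_gram adj) gs.
  by case/existsP: no4; exists (Tuple sz); rewrite gs.
have ok := hexagon_cert_ok; rewrite -{1}gh in ok.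
case: (refute_baseP (avoids1 av) _ ok) => g; rewrite -gh; exact: traces_all.
Qed.

Definition good_hexagon (h : seq T) : Prop :=
  [/\ gram h = core 0, forall z, 2 <= count id (take 6 (trace h z))
    & forall z z', adj z z' -> ~~ opposite (trace h z) (trace h z')].

Lemma good_hexagon_of_traces s tr : gram (take 7 s) = core 0 ->
  good_traces tr -> (forall g, trace s g \in tr) -> good_hexagon (take 7 s).
Proof.
move=> gs /allP good tr_all.
have take6 g : take 6 (trace (take 7 s) g) = take 6 (trace s g).
  by rewrite -take_trace take_takel.
split=> // [z|z z' zz'].
  by rewrite take6; have /andP[] := good _ (tr_all z); rewrite /few -leqNgt.
have /andP[_ /allP /(_ _ (tr_all z'))] := good _ (tr_all z).
by rewrite (disj_trace tf) // /opposite !take6.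
Qed.

Lemma core6_hexagon s : gram s = core 6 -> good_hexagon (take 7 s).
Proof.
move=> gs; have tr_all g : trace s g \in core6_traces.
  rewrite /core6_traces -gs; apply: (prune_complete x0 _ (avoids1 avoids_impossible)) => h.
  exact: traces_all.
have ok := core6_degree_cert_ok; rewrite -{1}gs in ok.
have few_no := refuteP (avoids1 avoids_impossible) tr_all ok.
apply: (good_hexagon_of_traces _ core6_good).
  by rewrite gram_take gs; vm_compute.
by move=> g; rewrite mem_filter few_no tr_all.
Qed.

Lemma core6_ends s : gram s = core 6 -> (forall g, ends_ok (trace s g)) -> False.
Proof.
move=> gs ends; have ok := core6_ends_cert_ok; rewrite -{1}gs in ok.
apply: (refute_baseP (avoids1 avoids_impossible) _ ok) => g.
by rewrite mem_filter ends -gs traces_all.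
Qed.

Section NoCore6.
Hypothesis no6 : avoids (no_core 6).

Lemma core4_not_deficient s g : gram s = core 4 -> trace s g \notin deficient.
Proof.
move=> gs; apply/negP => /(nthP [::])[k lt_k tE].
have /(allP deficient_certs_ok) : k \in iota 0 3 by rewrite mem_iota.
rewrite -{1}gs => ok.
have := refuteP (avoids2 avoids_impossible no6) (prune_core4 gs avoids_impossible) ok g.
by rewrite /= tE eqxx.
Qed.

Lemma mem_core4_traces s g : gram s = core 4 -> trace s g \in core4_traces.
Proof.
move=> gs; rewrite mem_filter -{1}gs traces_all andbT.
have av : avoids (core4_without (impossible ++ deficient)).
  apply: avoids_orbit => t gt h.
  by rewrite mem_cat negb_or core4_impossible // core4_not_deficient.
exact: av.
Qed.

Lemma top_no_bad_tops s z g : gram s = core 4 -> trace s z = top -> trace s g \notin bad_tops.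
Proof.
move=> gs sz; have gsz : gram (rcons s z) = add_row (core 4) top.
  by rewrite (gram_rcons adj_sym adj_irr) gs sz.
have ok := two_tops_cert_ok; rewrite -{1}gsz in ok.
have szs : size s = 11 by rewrite -(size_gram adj) gs.
have := refuteP (avoids2 avoids_impossible no6) _ ok g; cbv beta.
have -> : take 11 (trace (rcons s z) g) = trace s g.
  by rewrite take_trace -cats1 take_size_cat.
apply=> h.
by rewrite -gsz; apply: (prune_complete x0 _ (avoids1 avoids_impossible)) => h'; apply: traces_all.
Qed.

Lemma good_core4 s : gram s = core 4 -> (forall g, trace s g \notin bad_tops) ->
  good_hexagon (take 7 s).
Proof.
move=> gs ok; apply: (good_hexagon_of_traces _ core4_good).
  by rewrite gram_take gs; vm_compute.
by move=> g; rewrite mem_filter ok mem_core4_traces.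
Qed.

(* At most one kind of [top] can occur, so after an automorphism of the Groetzsch graph
   the hexagon is one on which the occurring kind has three neighbours. *)
Lemma good_hexagon_no_core6 s : gram s = core 4 ->
  exists s', gram s' = core 4 /\ good_hexagon (take 7 s').
Proof.
move=> gs; case: (boolP [exists z, has (fun f => restrict f (trace s z) == top) core4_auts]).
  case/existsP=> z /hasP[f fin /eqP tz]; have [gf trf] := core4_aut gs fin.
  exists [seq nth x0 s i | i <- f]; split=> //; apply: good_core4 => // g.
  by apply: (top_no_bad_tops (z := z)); rewrite ?trf.
move=> no_top; exists s; split=> //; apply: good_core4 => // g.
apply/negP => /(allP bad_tops_orbit) top_g.
by case/existsP: no_top; exists g.
Qed.
End NoCore6.

Lemma good_hexagon_exists h : gram h = core 0 ->
  exists s, gram s = core 4 /\ good_hexagon (take 7 s).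
Proof.
move=> /hexagon_core4[s gs].
have [/existsP[t /eqP gt]|no6] := boolP [exists t : 13.-tuple T, gram t == core 6].
  exists (take 11 t); rewrite take_takel //; split; last exact: core6_hexagon.
  by rewrite gram_take gt; vm_compute.
apply: good_hexagon_no_core6 gs => t gt g; have sz : size t == 13 by rewrite -(size_gram adj) gt.
by case/existsP: no6; exists (Tuple sz); rewrite gt.
Qed.
End Local.

(** * Positions in Andrasfai graphs *)

(* The vertex [j * k mod (3 * k - 1)] at the [j]-th position of the word. *)
Definition gpos (k j : nat) : nat := (j %% 3) * k + j %/ 3.

Lemma gposP k j : exists t, [\/ j = 3 * t /\ gpos k j = t, j = 3 * t + 1 /\ gpos k j = k + t
  | j = 3 * t + 2 /\ gpos k j = 2 * k + t].
Proof.
exists (j %/ 3); have := divn_eq j 3; have := ltn_pmod j (isT : 0 < 3); rewrite /gpos.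
move: (j %% 3) (j %/ 3) => [|[|[|r]]] t // _ ->; [apply: Or31|apply: Or32|apply: Or33].
all: by rewrite mulnC ?addn0 ?mul1n.
Qed.

Lemma gpos_lt k j : j < 3 * k - 1 -> gpos k j < 3 * k - 1.
Proof. by have [t [] [-> ->]] := gposP k j; lia. Qed.

Lemma circ_sub n a b : a < n -> b < n ->
  (a + n - b) %% n = if b <= a then a - b else a + n - b.
Proof.
move=> lt_a lt_b; case: leqP => le_ab; last by rewrite modn_small //; lia.
have -> : a + n - b = a - b + n by lia.
by rewrite modnDr modn_small //; lia.
Qed.

Lemma gpos_adj k (p q : 'I_(3 * k - 1)) i j : i < 3 * k - 1 -> j < 3 * k - 1 ->
  p = gpos k i :> nat -> q = gpos k j :> nat -> andrasfai_adj k p q = word_adj i j.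
Proof.
move=> lt_i lt_j; rewrite /andrasfai_adj => -> ->; rewrite circ_sub ?gpos_lt //.
have [t Hi] := gposP k i; have [t' Hj] := gposP k j.
by case: Hi => -[ei ->]; case: Hj => -[ej ->]; move: lt_i lt_j; rewrite ei ej /word_adj;
  clear => lt_i lt_j; case: ifP; lia.
Qed.

Lemma gpos_onto k v : v < 3 * k - 1 -> exists2 j, j < 3 * k - 1 & gpos k j = v.
Proof.
move=> lt_v; case: (ltnP v k) => [lt1|le1].
  exists (3 * v); first lia.
  by have [t [] [e ->]] := gposP k (3 * v); lia.
case: (ltnP v (2 * k)) => [lt2|le2].
  exists (3 * (v - k) + 1); first lia.
  by have [t [] [e ->]] := gposP k (3 * (v - k) + 1); lia.
exists (3 * (v - 2 * k) + 2); first lia.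
by have [t [] [e ->]] := gposP k (3 * (v - 2 * k) + 2); lia.
Qed.

(** * Graphs without induced hexagons *)

Definition hexagon (T : Type) (adj : rel T) (a b c u v w : T) : bool :=
  [&& adj a v, adj v c, adj c u, adj u b & adj b w] &&
  [&& adj w a, ~~ adj a u, ~~ adj b v & ~~ adj c w].

Section Hexagons.
Variables (T : finType) (adj : rel T) (x0 : T).
Hypotheses (adj_sym : symmetric adj) (adj_irr : irreflexive adj).
Hypothesis tf : triangle_free adj.
Hypothesis common : forall x y, ~~ adj x y -> exists z, adj z x && adj z y.

Lemma nadj_share x y z : adj z x -> adj z y -> ~~ adj x y.
Proof. by move=> zx zy; apply/negP => xy; apply: (tf (conj zx (conj xy zy))). Qed.

Lemma hexagon_swap a b c u v w : hexagon adj a b c u v w -> hexagon adj u v w a b c.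
Proof.
case/andP=> /and5P[av vc cu ub bw] /and4P[wa nau nbv ncw].
rewrite /hexagon ub bw wa av vc cu (adj_sym u) nau (adj_sym v) nbv (adj_sym w) ncw.
by [].
Qed.

Lemma hexagon_gram a b c u v w : hexagon adj a b c u v w ->
  gram adj [:: a; b; c; u; v; w] = [seq take 6 r | r <- take 6 (core 0)].
Proof.
case/andP=> /and5P[av vc cu ub bw] /and4P[wa /negbTE nau /negbTE nbv /negbTE ncw].
have share x y z : adj z x -> adj z y -> adj x y = false.
  by move=> zx zy; apply/negbTE; apply: nadj_share zx zy.
have ab : adj a b = false by apply: (share _ _ w); rewrite // adj_sym.
have bc : adj b c = false by apply: (share _ _ u); rewrite // adj_sym.
have ac : adj a c = false by apply: (share _ _ v); rewrite // adj_sym.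
have uv : adj u v = false by apply: (share _ _ c); rewrite // adj_sym.
have vw : adj v w = false by apply: (share _ _ a); rewrite // adj_sym.
have uw : adj u w = false by apply: (share _ _ b); rewrite // adj_sym.
rewrite /gram /trace /= !adj_irr ?(adj_sym b a) ?(adj_sym c a) ?(adj_sym c b) ?(adj_sym u a).
rewrite ?(adj_sym u c) ?(adj_sym v a) ?(adj_sym v b) ?(adj_sym v u) ?(adj_sym w b) ?(adj_sym w c).
rewrite ?(adj_sym w u) ?(adj_sym w v) ?(adj_sym a w) ?(adj_sym b u) ?(adj_sym c v).
by rewrite ab bc ac uv vw uw av vc cu ub bw wa nau nbv ncw.
Qed.

Lemma hexagon_gram7 a b c u v w x : hexagon adj a b c u v w -> adj x a -> adj x b -> adj x c ->
  gram adj [:: a; b; c; u; v; w; x] = core 0.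
Proof.
move=> hex xa xb xc; rewrite -[_ :: _]/(rcons [:: a; b; c; u; v; w] x) (gram_rcons adj_sym adj_irr).
rewrite hexagon_gram //; case/andP: hex => /and5P[av vc cu ub bw] /andP[wa _].
have share y z : adj z y -> adj x z -> adj x y = false.
  by move=> zy xz; apply/negbTE; apply: (@nadj_share _ _ z); rewrite // adj_sym.
rewrite /trace /= xa xb xc (share u c) // (share v a) // (share w b) //.
Qed.

Lemma helly x y z : (forall a b c u v w, ~~ hexagon adj a b c u v w) ->
  ~~ adj x y -> ~~ adj y z -> ~~ adj x z -> exists t, [/\ adj t x, adj t y & adj t z].
Proof.
move=> nohex nxy nyz nxz.
have [r1 /andP[r1x r1y]] := common nxy; have [r2 /andP[r2y r2z]] := common nyz.
have [r3 /andP[r3x r3z]] := common nxz.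
case r1z : (adj r1 z); first by exists r1.
case r2x : (adj r2 x); first by exists r2.
case r3y : (adj r3 y); first by exists r3.
case/negP: (nohex x y z r2 r3 r1); rewrite /hexagon !(adj_sym x) !(adj_sym y) !(adj_sym z).
by rewrite r3x r3z r2z r2y r1y r1x r1z r2x r3y.
Qed.

Hypothesis nohex : forall a b c u v w, ~~ hexagon adj a b c u v w.

Definition nbr (x : T) : {set T} := [set y | adj x y].

Lemma nested_or_cover p z z' : ~~ adj p z -> ~~ adj p z' -> ~~ adj z z' ->
  [\/ nbr z :&: nbr p \subset nbr z', nbr z' :&: nbr p \subset nbr z
    | nbr p \subset nbr z :|: nbr z'].
Proof.
move=> npz npz' nzz'.
have [|/subsetPn[q]] := boolP (nbr z :&: nbr p \subset nbr z'); first by move=> ?; apply: Or31.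
rewrite !inE => /andP[zq pq] nz'q.
have [|/subsetPn[q']] := boolP (nbr z' :&: nbr p \subset nbr z); first by move=> ?; apply: Or32.
rewrite !inE => /andP[z'q' pq'] nzq'.
have [|/subsetPn[r]] := boolP (nbr p \subset nbr z :|: nbr z'); first by move=> ?; apply: Or33.
rewrite !inE negb_or => pr /andP[nzr nz'r]; exfalso.
have [g1 [g1q g1z' g1r]] : exists t, [/\ adj t q, adj t z' & adj t r].
  by apply: helly => //; [rewrite adj_sym|apply: nadj_share pq pr].
have [g2 [g2q' g2z g2r]] : exists t, [/\ adj t q', adj t z & adj t r].
  by apply: helly => //; [rewrite adj_sym|apply: nadj_share pq' pr].
case/negP: (nohex z q' g1 z' q g2).
rewrite /hexagon zq (adj_sym q) g1q g1z' z'q' (adj_sym q') g2q' g2z nzz' (nadj_share pq' pq).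
by rewrite (@nadj_share _ _ r) // adj_sym.
Qed.

(* The colour classes are N(p), N(q) and the rest, where q lies in a minimal N(z0) :&: N(p).
   Every vertex of the rest is adjacent to z0, so the rest is independent. *)
Lemma no_hexagon_colouring : exists c : T -> nat,
  (forall x, c x < 3) /\ forall x y, adj x y -> c x != c y.
Proof.
pose p := x0; pose S z := nbr z :&: nbr p.
have npp : ~~ adj p p by rewrite adj_irr.
pose z0 := [arg min_(z < p | ~~ adj p z) #|S z|].
have [npz0 z0_min] : ~~ adj p z0 /\ forall z, ~~ adj p z -> #|S z0| <= #|S z|.
  by rewrite /z0; case: arg_minnP => // z ? ?; split.
have [q /andP[qp qz0]] := common npz0.
have pq : adj p q by rewrite adj_sym.
have S_min z : adj z q -> S z0 \subset S z.
  move=> zq; have npz : ~~ adj p z by apply: (nadj_share (z := q)); rewrite // adj_sym.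
  have nzz0 : ~~ adj z z0 by apply: (nadj_share (z := q)); rewrite // adj_sym.
  rewrite subsetI subsetIr andbT.
  case: (nested_or_cover npz npz0 nzz0) => [sub|//|cover].
    have : S z == S z0.
      by rewrite eqEcard z0_min // andbT subsetI sub subsetIr.
    by move/eqP <-; apply: subsetIl.
  apply/subsetP => m; rewrite !inE => /andP[z0m pm]; apply: contraT => nzm.
  have [z' /andP[z'z z'm]] := common nzm.
  have npz' : ~~ adj p z' by apply: (nadj_share (z := m)); rewrite // adj_sym.
  have lt : #|S z'| < #|S z0|.
    apply/proper_card/properP; split.
      apply/subsetP => y; rewrite !inE => /andP[z'y py]; rewrite py andbT.
      have := subsetP cover y; rewrite !inE => /(_ py) /orP[zy|//].
      by case: (tf (conj z'z (conj zy z'y))).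
    exists q; rewrite !inE ?pq ?andbT; first by rewrite adj_sym.
    by apply/negP => z'q; apply: (tf (conj z'z (conj zq z'q))).
  by have := z0_min _ npz'; rewrite leqNgt lt.
have outer_z0 z : ~~ adj p z -> ~~ adj q z -> adj z z0.
  move=> npz nqz; apply: contraT => nzz0.
  have [r /andP[rq rz]] := common nqz.
  have [t [tp tz tz0]] := helly nohex npz nzz0 npz0.
  have : t \in S r by apply: (subsetP (S_min _ rq)); rewrite !inE adj_sym tz0 adj_sym.
  by rewrite !inE => /andP[rt _]; case: (tf (conj rt (conj tz rz))).
exists (fun x => if adj p x then 0 else if adj q x then 1 else 2); split=> [x|x y xy].
  by case: ifP => // _; case: ifP.
case px: (adj p x); case py: (adj p y) => //; first by case: (tf (conj px (conj xy py))).
  by case: ifP.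
  by case: ifP.
case qx: (adj q x); case qy: (adj q y) => //; first by case: (tf (conj qx (conj xy qy))).
have xz0 : adj x z0 by apply: outer_z0; rewrite ?px ?qx.
have yz0 : adj y z0 by apply: outer_z0; rewrite ?py ?qy.
by case: (tf (conj xy (conj yz0 xz0))).
Qed.
End Hexagons.

(* In a word of length [3 * k] the last vertex is a twin of the first. *)
Lemma word_adj_wrap k i j : i < 3 * k -> j < 3 * k ->
  word_adj i j = word_adj (if i < 3 * k - 1 then i else 0) (if j < 3 * k - 1 then j else 0).
Proof. by rewrite /word_adj => lt_i lt_j; case: (ltnP i (3 * k - 1)); case: (ltnP j (3 * k - 1)); lia. Qed.

Lemma andrasfai_blowup (T : finType) (adj : rel T) (x0 : T) :
  symmetric adj -> irreflexive adj -> triangle_free adj ->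
  (forall x y, ~~ adj x y -> exists z, adj z x && adj z y) ->
  (forall a b c u v w, ~~ hexagon adj a b c u v w) ->
  exists k, 1 <= k /\ blowup adj (andrasfai_adj k).
Proof.
move=> adj_sym adj_irr tf common nohex.
have [c [c_lt c_adj]] := no_hexagon_colouring x0 adj_sym adj_irr tf common nohex.
have [|||h [n [s [_ h_lt level _ adjE]]]] :=
    @word_structure T adj predT c adj_sym tf (fun x _ => c_lt x) (fun x y _ _ => c_adj x y).
- move=> x y _ _ _ /common[z /andP[zx zy]]; by exists z.
- move=> x y z _ _ _ cxy cyz cxz nxy nyz nxz.
  have [t [tx ty tz]] := helly adj_sym common nohex nxy nyz nxz.
  move: (c_adj _ _ tx) (c_adj _ _ ty) (c_adj _ _ tz) (c_lt t) (c_lt x) (c_lt y) (c_lt z) cxy cyz cxz.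
  by clear; lia.
- by exists x0.
have {}adjE x y : adj x y = word_adj (h x) (h y) by apply: adjE.
have {}h_lt x : h x < n by apply: h_lt.
have [y0 /andP[_ xy0]] : exists z, adj z x0 && adj z x0 by apply: common; rewrite adj_irr.
have n_ge2 : 2 <= n by move: xy0 (h_lt x0) (h_lt y0); rewrite adjE /word_adj; clear; lia.
have n_mod : n %% 3 != 1.
  apply/negP => /eqP n1.
  have [x _ hx] := level 0 (ltnW n_ge2).
  have [|y _ hy] := level n.-1; first by rewrite ltn_predL ltnW.
  have [|z /andP[zx zy]] := @common x y; rewrite ?adjE.
    by rewrite hx hy /word_adj; move: n_ge2 n1; clear; lia.
  by move: zx zy (h_lt z); rewrite !adjE hx hy /word_adj; move: n_ge2 n1; clear; lia.
pose k := n.+1 %/ 3.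
have h_le x : h x < 3 * k by move: (h_lt x) n_mod; rewrite /k; clear; lia.
have n_ge : 3 * k - 1 <= n by rewrite /k; clear; lia.
have k_gt0 : 0 < k by move: n_ge2; rewrite /k; clear; lia.
pose idx x := if h x < 3 * k - 1 then h x else 0.
have idx_lt x : idx x < 3 * k - 1 by rewrite /idx; case: ifP => // _; move: k_gt0; clear; lia.
exists k; split=> //; exists (fun x => Ordinal (gpos_lt (idx_lt x))); split=> //.
split=> [v _|x y]; last first.
  by rewrite adjE (word_adj_wrap (h_le x) (h_le y)); symmetry; apply: gpos_adj => //; apply: idx_lt.
have [j lt_j gj] := gpos_onto (ltn_ord v).
have [x _ hx] := level j (leq_trans lt_j n_ge).
by exists x; apply: val_inj; rewrite /= /idx hx lt_j.
Qed.

(** * Vega graphs from a good hexagon *)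

Definition letter_row (l : nat) : bitseq := [seq vega_letter_adj l j | j <- iota 0 6].
Definition letter_rows : seq bitseq := [seq letter_row l | l <- iota 0 8].
Definition class_rows : seq bitseq := [seq bits 6 [:: k; k + 3] | k <- iota 0 3].
Definition type_rows : seq bitseq := class_rows ++ letter_rows.

Definition compatible (t u : bitseq) : bool := [&& disj t u, ~~ opposite t u & ~~ opposite u t].

(* A common neighbour of two vertices is compatible with both.  Hence compatible vertices are
   adjacent, unless both belong to the word. *)
Lemma type_rows_closed : allrel (fun t u =>
    [|| (t \in class_rows) && (u \in class_rows), ~~ compatible t u |
       all (fun r => ~~ (compatible r t && compatible r u)) type_rows]) type_rows type_rows.
Proof. by vm_cast_no_check (erefl true). Qed.

Lemma class_rows_closed : allrel (fun t u => (t == u) ||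
    all (fun r => disj r t && disj r u ==> (r \in class_rows)) type_rows) class_rows class_rows.
Proof. by vm_cast_no_check (erefl true). Qed.

Lemma class_rows_meet :
  all (fun r => has (fun t => ~~ disj r t) class_rows) type_rows.
Proof. by vm_cast_no_check (erefl true). Qed.

Lemma letter_letter : allrel (fun l m =>
  compatible (letter_row l) (letter_row m) == vega_letter_adj l m) (iota 0 8) (iota 0 8).
Proof. by vm_cast_no_check (erefl true). Qed.

Lemma class_letter : allrel (fun k l =>
  compatible (bits 6 [:: k; k + 3]) (letter_row l) == (l < 6) && (l %% 3 == k))
  (iota 0 3) (iota 0 8).
Proof. by vm_cast_no_check (erefl true). Qed.

Lemma few_types : all (fun t => few t || (t \in type_rows))
  (traces_of [seq take 6 r | r <- take 6 (core 0)]).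
Proof. by vm_cast_no_check (erefl true). Qed.

Lemma letter_rows_uniq : uniq letter_rows. Proof. by vm_cast_no_check (erefl true). Qed.

Section Hex.
Variables (T : finType) (adj : rel T).
Hypotheses (adj_sym : symmetric adj) (adj_irr : irreflexive adj).
Hypothesis tf : triangle_free adj.
Hypothesis common : forall x y, ~~ adj x y -> exists z, adj z x && adj z y.
Hypothesis Q4 : property_Q 4 adj.

Definition no_opposite (a b c u v w : T) : Prop := forall z z', adj z z' ->
  adj z v -> adj z w -> adj z' b -> adj z' c -> adj z u || adj z' a.

Definition good_letters (a b c u v w x : T) : Prop :=
  [/\ hexagon adj a b c u v w, [/\ adj x a, adj x b & adj x c],
      forall z, 2 <= adj z a + adj z b + adj z c + adj z u + adj z v + adj z w
    & [/\ no_opposite a b c u v w, no_opposite b c a v w u & no_opposite c a b w u v]].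

Lemma good_letters_rot a b c u v w x : good_letters a b c u v w x -> good_letters b c a v w u x.
Proof.
case=> hex [xa xb xc] deg [oa ob oc]; split=> //; last by move=> z; have := deg z; lia.
case/andP: hex => /and5P[av vc cu ub bw] /and4P[wa nau nbv ncw].
by rewrite /hexagon bw wa av vc cu ub nbv ncw nau.
Qed.

Lemma good_letters_of_hexagon a b c u v w x :
  good_hexagon adj [:: a; b; c; u; v; w; x] -> good_letters a b c u v w x.
Proof.
set h := [:: a; b; c; u; v; w; x]; case=> gh deg opp.
have E i j : i < 7 -> j < 7 -> adj (nth a h i) (nth a h j) = core_adj i j.
  move=> lt_i lt_j; have : nth false (nth [::] (gram adj h) i) j = core_adj i j.
    by rewrite gh /core !(nth_map 0) ?size_iota ?nth_iota.
  by rewrite (nth_map a) // (nth_map a).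
have av : adj a v := E 0 4 isT isT; have vc : adj v c := E 4 2 isT isT.
have cu : adj c u := E 2 3 isT isT; have ub : adj u b := E 3 1 isT isT.
have bw : adj b w := E 1 5 isT isT; have wa : adj w a := E 5 0 isT isT.
have va : adj v a := E 4 0 isT isT; have cv : adj c v := E 2 4 isT isT.
have uc : adj u c := E 3 2 isT isT; have bu : adj b u := E 1 3 isT isT.
have wb : adj w b := E 5 1 isT isT; have aw : adj a w := E 0 5 isT isT.
have share z y y' : adj y y' -> adj z y -> adj z y' = false.
  by move=> yy zy; apply/negbTE/negP => zy'; apply: (tf (conj zy (conj yy zy'))).
split.
- by rewrite /hexagon av vc cu ub bw wa (E 0 3) // (E 1 4) // (E 2 5).
- by split; [apply: (E 6 0)|apply: (E 6 1)|apply: (E 6 2)].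
- by move=> z; have := deg z; rewrite /trace /= addn0 !addnA.
split=> z z' zz' z1 z2 z'1 z'2; apply: contraT; rewrite negb_or => /andP[/negbTE z3 /negbTE z'3];
  have := opp z z' zz'; rewrite /opposite /trace /= z1 z2 z3 z'1 z'2 z'3.
- by rewrite (share z w a) // (share z w b) // (share z v c) // (share z' b u) //
    (share z' c v) // (share z' b w).
- by rewrite (share z w a) // (share z w b) // (share z u c) // (share z' c u) //
    (share z' c v) // (share z' a w).
- by rewrite (share z v a) // (share z u b) // (share z v c) // (share z' b u) //
    (share z' a v) // (share z' b w).
Qed.

Lemma hexagon_centre a b c u v w : hexagon adj a b c u v w ->
  exists t, [/\ adj t a, adj t b & adj t c] \/ [/\ adj t u, adj t v & adj t w].
Proof.
move=> hex; have [|t] := @hit_exists T adj a common Q4 [:: a; b; c; u; v; w] (Weigh (nseq 6 1)).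
  by rewrite (hexagon_gram adj_sym adj_irr tf hex); vm_compute.
rewrite /hits /weight /= => wt; exists t.
case/andP: hex => /and5P[av vc cu ub bw] /andP[wa _].
have share x y : adj x y -> adj t x -> adj t y -> False.
  by move=> xy tx ty; apply: (tf (conj tx (conj xy ty))).
move: (share _ _ av) (share _ _ vc) (share _ _ cu) (share _ _ ub) (share _ _ bw) (share _ _ wa) wt.
case: (adj t a); case: (adj t b); case: (adj t c); case: (adj t u); case: (adj t v); case: (adj t w) => //=.
all: try by [left|right|move=> *; exfalso; auto].
Qed.
End Hex.

Definition in_class (T : Type) (adj : rel T) (a b c u v w z : T) : bool :=
  [|| adj z a && adj z u, adj z b && adj z v | adj z c && adj z w].

Definition class (T : Type) (adj : rel T) (a b c u v w z : T) : nat :=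
  if adj z a && adj z u then 0 else if adj z b && adj z v then 1 else 2.

Lemma third_of_three i j k l : i < 3 -> j < 3 -> k < 3 -> l < 3 ->
  i != j -> j != k -> i != k -> l != i -> l != j -> l = k.
Proof. lia. Qed.

Section Letters.
Variables (T : finType) (adj : rel T) (a b c u v w x : T).
Hypotheses (adj_sym : symmetric adj) (adj_irr : irreflexive adj).
Hypothesis tf : triangle_free adj.
Hypothesis common : forall x y, ~~ adj x y -> exists z, adj z x && adj z y.
Hypothesis Q4 : property_Q 4 adj.
Hypothesis good : good_letters adj a b c u v w x.

Local Notation H := [:: a; b; c; u; v; w].
Local Notation D := (in_class adj a b c u v w).
Local Notation col := (class adj a b c u v w).
Local Notation tr := (trace adj H).

Let hex : hexagon adj a b c u v w. Proof. by case: good. Qed.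

Lemma trace_types z : tr z \in type_rows.
Proof.
have tz : tr z \in traces_of [seq take 6 r | r <- take 6 (core 0)].
  by rewrite -(hexagon_gram adj_sym adj_irr tf hex); apply: traces_complete.
have [|//] := orP (allP few_types _ tz).
rewrite /few /trace /= addn0 !addnA ltnNge.
by case: good => _ _ ->.
Qed.

Lemma adj_compatible z z' : adj z z' -> compatible (tr z) (tr z').
Proof.
suff no z1 z2 : adj z1 z2 -> ~~ opposite (tr z1) (tr z2).
  by move=> zz'; rewrite /compatible (disj_trace tf) // !no // adj_sym.
case: good => _ _ _ [oa ob oc] zz; apply/negP; rewrite /opposite /trace /= !inE !xpair_eqE.
rewrite /bits /= !eqseq_cons !andbT.
case/or3P=> /andP[]; case/and5P=> /eqP a1 /eqP b1 /eqP c1 /eqP u1 /andP[/eqP v1 /eqP w1];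
  case/and5P=> /eqP a2 /eqP b2 /eqP c2 /eqP u2 /andP[/eqP v2 /eqP w2].
- by have := oa _ _ zz v1 w1 b2 c2; rewrite u1 a2.
- by have := ob _ _ zz w1 u1 c2 a2; rewrite v1 b2.
- by have := oc _ _ zz u1 v1 a2 b2; rewrite w1 c2.
Qed.

Lemma adjE_type z z' : ~~ ((tr z \in class_rows) && (tr z' \in class_rows)) ->
  adj z z' = compatible (tr z) (tr z').
Proof.
move=> ncl; apply/idP/idP => [/adj_compatible //|cmp]; apply: contraT => nzz'.
case/or3P: (allrelP type_rows_closed _ _ (trace_types z) (trace_types z')).
- by rewrite (negbTE ncl).
- by rewrite cmp.
move=> /allP no.
have [g /andP[gz gz']] := common nzz'.
by move: (no _ (trace_types g)); rewrite !adj_compatible.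
Qed.

Lemma in_classE z : D z = (tr z \in class_rows).
Proof.
have := trace_types z; rewrite /in_class /trace /=.
by case: (adj z a); case: (adj z b); case: (adj z c); case: (adj z u); case: (adj z v); case: (adj z w).
Qed.

Lemma classE z : D z -> tr z = bits 6 [:: col z; col z + 3].
Proof.
have := trace_types z; rewrite /in_class /class /trace /=.
by case: (adj z a); case: (adj z b); case: (adj z c); case: (adj z u); case: (adj z v); case: (adj z w).
Qed.

Lemma class_lt z : col z < 3. Proof. by rewrite /class; case: ifP => // _; case: ifP. Qed.

Lemma class_eq z z' : D z -> D z' -> (tr z == tr z') = (col z == col z').
Proof.
move=> Dz Dz'; rewrite !classE //; have := class_lt z; have := class_lt z'.
by case: (col z) => [|[|[|//]]]; case: (col z') => [|[|[|//]]].
Qed.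

Lemma class_adj z z' : D z -> D z' -> adj z z' -> col z != col z'.
Proof.
move=> Dz Dz' zz'; have := disj_trace tf H zz'; rewrite !classE //.
have := class_lt z; have := class_lt z'.
by case: (col z) => [|[|[|//]]]; case: (col z') => [|[|[|//]]].
Qed.

Lemma class_common z z' : D z -> D z' -> col z != col z' -> ~~ adj z z' ->
  exists g, [/\ D g, adj g z & adj g z'].
Proof.
move=> Dz Dz' czz' /common[g /andP[gz gz']]; exists g; split=> //.
move: (Dz) (Dz'); rewrite !in_classE => tz tz'.
have := allrelP class_rows_closed _ _ tz tz'.
rewrite class_eq // (negbTE czz') => /allP /(_ _ (trace_types g)).
by rewrite !(disj_trace tf).
Qed.

Lemma class_no_meet z1 z2 z3 g : D z1 -> D z2 -> D z3 ->
  col z1 != col z2 -> col z2 != col z3 -> col z1 != col z3 ->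
  adj g z1 -> adj g z2 -> adj g z3 -> False.
Proof.
move=> D1 D2 D3 c12 c23 c13 g1 g2 g3.
have dis t : t \in class_rows -> disj (tr g) t.
  have : t \in class_rows -> t \in [:: tr z1; tr z2; tr z3].
    rewrite !inE !classE //; move: c12 c23 c13; have := class_lt z1; have := class_lt z2.
    have := class_lt z3; case: (col z1) => [|[|[|//]]]; case: (col z2) => [|[|[|//]]];
    by case: (col z3) => [|[|[|//]]] // _ _ _ _ _ _; case/or3P=> /eqP->.
  by move=> h /h; rewrite !inE => /or3P[] /eqP->; apply: disj_trace.
by have [t /dis->] := hasP (allP class_rows_meet _ (trace_types g)).
Qed.

Lemma class_no_rainbow z1 z2 z3 : D z1 -> D z2 -> D z3 ->
  col z1 != col z2 -> col z2 != col z3 -> col z1 != col z3 ->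
  ~~ adj z1 z2 -> ~~ adj z2 z3 -> ~~ adj z1 z3 -> False.
Proof.
move=> D1 D2 D3 c12 c23 c13 n12 n23 n13.
have [r12 [Dr12 r12_1 r12_2]] := class_common D1 D2 c12 n12.
have [r23 [Dr23 r23_2 r23_3]] := class_common D2 D3 c23 n23.
have [r13 [Dr13 r13_1 r13_3]] := class_common D1 D3 c13 n13.
have third y y1 y2 y3 : D y -> D y1 -> D y2 -> col y1 != col y2 -> col y2 != col y3 ->
    col y1 != col y3 -> adj y y1 -> adj y y2 -> col y = col y3.
  move=> Dy Dy1 Dy2 c_12 c_23 c_13 yy1 yy2.
  apply: (@third_of_three (col y1) (col y2)); rewrite ?class_lt // ; exact: class_adj.
have e12 : col r12 = col z3 by apply: (third _ z1 z2).
have e13 : col r13 = col z2 by apply: (third _ z1 z3); rewrite // eq_sym.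
have e23 : col r23 = col z1 by apply: (third _ z2 z3); rewrite // eq_sym.
have same y y' : D y -> D y' -> col y = col y' -> ~~ adj y y'.
  by move=> Dy Dy' e; apply/negP => /(class_adj Dy Dy'); rewrite e eqxx.
have hx : hexagon adj z1 z2 z3 r23 r13 r12.
  rewrite /hexagon (adj_sym z1 r13) (adj_sym z3 r23) (adj_sym z2 r12).
  rewrite r13_1 r13_3 r23_3 r23_2 r12_2 r12_1 /=.
  by rewrite !same // ?e23 ?e13 ?e12.
have [t [[t1 t2 t3]|[t1 t2 t3]]] := hexagon_centre adj_sym adj_irr tf common Q4 hx.
  exact: (class_no_meet D1 D2 D3 c12 c23 c13 t1 t2 t3).
by apply: (class_no_meet Dr12 Dr13 Dr23 _ _ _ t3 t2 t1); rewrite ?e12 ?e13 ?e23 // eq_sym.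
Qed.
End Letters.

Lemma bits_opposite k j : j < 6 -> nth false (bits 6 [:: k; k + 3]) j = (j == k) || (j == k + 3).
Proof. by move=> lt_j; rewrite (nth_map 0) ?size_iota // nth_iota // !inE. Qed.

Section Vega.
Variables (T : finType) (adj : rel T) (a b c u v w x : T).
Hypotheses (adj_sym : symmetric adj) (adj_irr : irreflexive adj).
Hypothesis tf : triangle_free adj.
Hypothesis common : forall x y, ~~ adj x y -> exists z, adj z x && adj z y.
Hypothesis Q4 : property_Q 4 adj.
Hypothesis good : good_letters adj a b c u v w x.

Local Notation H := [:: a; b; c; u; v; w].
Local Notation D := (in_class adj a b c u v w).
Local Notation col := (class adj a b c u v w).
Local Notation tr := (trace adj H).

Variables (h : T -> nat) (n : nat).
Hypothesis h_lt : forall z, D z -> h z < n.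
Hypothesis level : forall l, l < n -> exists2 z, D z & h z = l.
Hypothesis col_h : forall z, D z -> col z = h z %% 3.
Hypothesis adj_h : forall z z', D z -> D z' -> adj z z' = word_adj (h z) (h z').
Hypothesis n_ge4 : 4 <= n.

Let hex : hexagon adj a b c u v w. Proof. by case: good. Qed.

Lemma gram7 : gram adj (rcons H x) = core 0.
Proof. by case: good => _ [xa xb xc] _ _; apply: hexagon_gram7. Qed.

Lemma letter_entry i j : i < 7 -> j < 7 ->
  adj (nth a (rcons H x) i) (nth a (rcons H x) j) = vega_letter_adj i j.
Proof.
move=> lt_i lt_j; have -> : vega_letter_adj i j = core_adj i j by rewrite /core_adj lt_i lt_j.
have : nth false (nth [::] (gram adj (rcons H x)) i) j = core_adj i j.
  by rewrite gram7 /core !(nth_map 0) ?size_iota ?nth_iota.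
by rewrite (nth_map a) // (nth_map a).
Qed.

Lemma letter_class z i : D z -> i < 7 ->
  adj z (nth a (rcons H x) i) = (i < 6) && (i %% 3 == col z).
Proof.
move=> Dz lt_i; have lt_c := class_lt adj a b c u v w z.
case: (ltnP i 6) => [lt6|ge6].
  have -> : nth a (rcons H x) i = nth a H i by rewrite nth_rcons lt6.
  have <- : nth false (tr z) i = adj z (nth a H i) by rewrite (nth_map a).
  rewrite (classE adj_sym adj_irr tf good) // bits_opposite //=.
  by move: lt_c lt6; move: (col z) => k; clear; lia.
have -> : i = 6 by lia.
apply/negbTE; case: good => _ [xa xb xc] _ _ /=.
have share y : adj x y -> adj z y -> ~~ adj z x.
  by move=> xy zy; apply: (nadj_share tf (z := y)); rewrite adj_sym.
by case/or3P: Dz => /andP[? _]; [apply: (share a)|apply: (share b)|apply: (share c)].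
Qed.

(* A word of length divisible by three would start in the class of [a] and end in that
   of [c]; together with the hexagon and its centre these ends contradict [property_Q 4]. *)
Lemma word_length_mod3 : n %% 3 != 0.
Proof.
apply/negP => /eqP n0; have n_ge6 : 6 <= n by move: n_ge4 n0; clear; lia.
pose lv := [:: 0; 1; 2; 3; 4; n.-1].
have [p0 Dp0 hp0] : exists2 z, D z & h z = 0 by apply: level; lia.
have [p1 Dp1 hp1] : exists2 z, D z & h z = 1 by apply: level; lia.
have [p2 Dp2 hp2] : exists2 z, D z & h z = 2 by apply: level; lia.
have [p3 Dp3 hp3] : exists2 z, D z & h z = 3 by apply: level; lia.
have [p4 Dp4 hp4] : exists2 z, D z & h z = 4 by apply: level; lia.
have [p5 Dp5 hp5] : exists2 z, D z & h z = n.-1 by apply: level; lia.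
pose ps := [:: p0; p1; p2; p3; p4; p5].
have psP i : i < 6 -> D (nth a ps i) /\ h (nth a ps i) = nth 0 lv i.
  by case: i => [|[|[|[|[|[|]]]]]].
pose s := rcons H x ++ ps.
have lvE i : i < 6 -> nth 0 lv i %% 3 = i %% 3.
  by case: i => [|[|[|[|[|[|]]]]]] //= _; move: n_ge6 n0; clear; lia.
have s_lo i : i < 7 -> nth a s i = nth a (rcons H x) i by move=> lt_i; rewrite nth_cat lt_i.
have s_hi i : nth a s (7 + i) = nth a ps i by rewrite nth_cat ltnNge leq_addr /= addKn.
have mixed i j : i < 7 -> j < 6 -> adj (nth a ps j) (nth a s i) = (i < 6) && (i %% 3 == j %% 3).
  move=> lt_i lt_j; have [Dp hp] := psP j lt_j.
  by rewrite s_lo // letter_class // col_h // hp lvE.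
have gs : gram adj s = core 6.
  apply: (@eq_from_nth _ [::]) => [|i]; rewrite size_gram // => lt_i.
  have -> : nth [::] (core 6) i = [seq core_adj i j | j <- iota 0 13].
    by rewrite /core (nth_map 0) ?size_iota // nth_iota.
  rewrite (nth_gram adj a) //; apply: (@eq_from_nth _ false) => [|j]; first by rewrite size_trace size_map size_iota.
  rewrite size_trace => lt_j; rewrite (nth_map a) // (nth_map 0) ?size_iota // nth_iota // add0n.
  rewrite /core_adj; case: (ltnP i 7) => [lt_i7|ge_i7]; case: (ltnP j 7) => [lt_j7|ge_j7].
  - by rewrite !s_lo // letter_entry.
  - by rewrite -(subnKC ge_j7) s_hi adj_sym mixed ?addKn // ltn_subLR.
  - by rewrite -(subnKC ge_i7) s_hi mixed ?addKn // ltn_subLR.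
  rewrite -(subnKC ge_i7) -(subnKC ge_j7) !s_hi !addKn.
  have lt_i6 : i - 7 < 6 by rewrite ltn_subLR.
  have lt_j6 : j - 7 < 6 by rewrite ltn_subLR.
  have [[Di hi] [Dj hj]] := (psP _ lt_i6, psP _ lt_j6).
  rewrite adj_h // hi hj; move: (i - 7) (j - 7) lt_i6 lt_j6 => i' j'; clear -n_ge6 n0.
  by case: i' => [|[|[|[|[|[|]]]]]] //; case: j' => [|[|[|[|[|[|]]]]]] //= _ _;
    rewrite /word_adj; lia.
apply: (core6_ends a adj_sym adj_irr tf common Q4 gs) => g; apply/and3P; split.
- rewrite /few /trace /= addn0 !addnA -leqNgt.
  by case: good => _ _ ->.
- rewrite /=; apply/negP => /and3P[gc gw gp].
  have Dg : D g by rewrite /in_class gc gw !orbT.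
  have cg : col g = 2.
    by move: gc; rewrite -[c]/(nth a (rcons H x) 2) letter_class //= => /eqP.
  move: gp; rewrite adj_h // hp0 /word_adj; move: cg; rewrite col_h //.
  by clear; lia.
rewrite /=; apply/negP => /and3P[ga gu gp].
have Dg : D g by rewrite /in_class ga gu.
have cg : col g = 0.
  by move: ga; rewrite -[a in adj g a]/(nth a (rcons H x) 0) letter_class //= => /eqP.
move: gp (h_lt Dg); rewrite adj_h // hp5 /word_adj; move: cg n0; rewrite col_h //.
by clear; lia.
Qed.

Lemma vega_letter_num_gpos i l j : l < 8 -> j < 3 * i - 1 ->
  vega_letter_num i l (gpos i j) = (l < 6) && (l %% 3 == j %% 3).
Proof.
rewrite /vega_letter_num => lt_l lt_j; have [t [] [ej ->]] := gposP i j; rewrite ej in lt_j *;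
  by case: l lt_l => [|[|[|[|[|[|[|[|//]]]]]]]] _ /=; move: lt_j; clear; lia.
Qed.

Lemma vega_blowup : exists (i : nat) (mu nu : bool),
  2 <= i /\ blowup_on adj (vega_adj i) (vega_vertices i mu nu).
Proof.
have n_mod := word_length_mod3.
pose i := (n + 2) %/ 3; pose nu := n == 3 * i - 2.
have i_ge2 : 2 <= i by rewrite /i; move: n_ge4; clear; lia.
have n_le : n <= 3 * i - 1 by rewrite /i; move: n_mod; clear; lia.
have n_ge : 3 * i - 2 <= n by rewrite /i; clear; lia.
pose mu := ~~ [exists z, tr z == letter_row 7].
pose idx z := if D z then h z else 0.
have idx_lt z : idx z < 3 * i - 1.
  rewrite /idx; case: ifP => [/h_lt hz|_]; first exact: leq_trans hz n_le.
  by move: i_ge2; clear; lia.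
pose let_of z := index (tr z) letter_rows.
have letP z : ~~ D z -> let_of z < 8 /\ tr z = letter_row (let_of z).
  rewrite (in_classE adj_sym adj_irr tf good) => ncl; have := trace_types adj_sym adj_irr tf good z.
  rewrite mem_cat (negbTE ncl) /= => tz; have lt_z : let_of z < 8 by rewrite /let_of -index_mem in tz *.
  by split=> //; rewrite -{1}(nth_index [::] tz) (nth_map 0) ?size_iota // nth_iota.
pose f z : 'I_(3 * i - 1) + 'I_8 :=
  if D z then inl (Ordinal (gpos_lt (idx_lt z))) else inr (inord (let_of z)).
exists i, mu, nu; split=> //; exists f; split; [|split].
- move=> z; rewrite /f; case: ifPn => [Dz|/letP[lt_z tz]] /=.
    rewrite /idx Dz; apply/negP => /andP[/eqP nuE /eqP].
    have := h_lt Dz; rewrite nuE; have [t [] [-> ->]] := gposP i (h z); clear; lia.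
  rewrite inordK //; apply/negP => /andP[/existsP no /eqP l7]; apply: no.
  by exists z; rewrite tz l7.
- case=> [j|l] /= ok.
    have [m lt_m gm] := gpos_onto (ltn_ord j).
    have [|z Dz hz] := @level m.
      move: ok; rewrite -gm /nu; case: eqP => [nE|] /=; last by move: n_ge n_le lt_m; clear; lia.
      move: lt_m; rewrite [in _ < n]nE; have [t [] [-> ->]] := gposP i m; move: i_ge2; clear; lia.
    exists z; rewrite /f Dz; congr inl; apply: val_inj; rewrite /= /idx Dz hz.
    exact: gm.
  have [z tz] : exists z, tr z = letter_row l.
    case: (ltnP l 7) => [lt7|ge7].
      exists (nth a (rcons H x) l); apply: (@eq_from_nth _ false) => [|k].
        by rewrite size_trace size_map size_iota.
      rewrite size_trace => lt_k; rewrite (nth_map a) // (nth_map 0) ?size_iota // nth_iota // add0n.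
      have -> : nth a H k = nth a (rcons H x) k by rewrite nth_rcons lt_k.
      by apply: letter_entry => //; apply: ltnW.
    have l7 : l = 7 :> nat by have := ltn_ord l; move: ge7; clear; lia.
    by move: ok; rewrite l7 andbT negbK => /existsP[z /eqP tz]; exists z.
  have nD : ~~ D z.
    rewrite (in_classE adj_sym adj_irr tf good) tz.
    by case: l {ok tz} => l /=; case: l => [|[|[|[|[|[|[|[|]]]]]]]].
  exists z; rewrite /f (negbTE nD); congr inr; apply: val_inj.
  have [lt_z tz'] := letP z nD; rewrite /= inordK //; rewrite /let_of tz.
  rewrite -[letter_row l](_ : nth [::] letter_rows l = _) ?index_uniq ?letter_rows_uniq //.
  by rewrite (nth_map 0) ?size_iota // nth_iota.
have cross z z' : D z -> ~~ D z' ->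
    adj z z' = vega_letter_num i (let_of z') (gpos i (h z)).
  move=> Dz nDz'; have [lt_l tl] := letP z' nDz'.
  have lt_h : h z < 3 * i - 1 by apply: leq_trans (h_lt Dz) n_le.
  rewrite vega_letter_num_gpos // -col_h //.
  rewrite (adjE_type adj_sym adj_irr tf common good).
    rewrite (classE adj_sym adj_irr tf good Dz) tl; apply/eqP.
    by apply: (allrelP class_letter); rewrite mem_iota ?class_lt.
  by rewrite -!(in_classE adj_sym adj_irr tf good) (negbTE nDz') andbF.
move=> z z'; rewrite /f; case: ifPn => Dz; case: ifPn => Dz' /=.
- have ez : idx z = h z by rewrite /idx Dz.
  have ez' : idx z' = h z' by rewrite /idx Dz'.
  by rewrite adj_h // -ez -ez'; symmetry; apply: gpos_adj.
- have [lt_l _] := letP _ Dz'.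
  by rewrite inordK // cross // /idx Dz.
- have [lt_l _] := letP _ Dz.
  by rewrite inordK // adj_sym cross // /idx Dz'.
have [lt_l tl] := letP _ Dz; have [lt_l' tl'] := letP _ Dz'.
rewrite !inordK // (adjE_type adj_sym adj_irr tf common good).
  by rewrite tl tl'; apply/eqP; apply: (allrelP letter_letter); rewrite mem_iota.
by rewrite -!(in_classE adj_sym adj_irr tf good) (negbTE Dz).
Qed.
End Vega.

Lemma word_adj_up t i j : (t + j) %% 3 = ((t + i) %% 3).+1 %% 3 -> word_adj i j -> i < j.
Proof. by rewrite /word_adj; lia. Qed.

Section Main.
Variables (T : finType) (adj : rel T).
Hypotheses (adj_sym : symmetric adj) (adj_irr : irreflexive adj).
Hypothesis tf : triangle_free adj.
Hypothesis common : forall x y, ~~ adj x y -> exists z, adj z x && adj z y.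
Hypothesis Q4 : property_Q 4 adj.

Lemma class_rot a b c u v w x z : good_letters adj a b c u v w x ->
  in_class adj b c a v w u z = in_class adj a b c u v w z /\
  (in_class adj a b c u v w z ->
   class adj b c a v w u z = (class adj a b c u v w z + 2) %% 3).
Proof.
case=> /andP[/and5P[av vc cu ub bw] /andP[wa _]] _ _ _.
have share y y' : adj y y' -> ~~ (adj z y && adj z y').
  by move=> yy; apply/negP => /andP[zy zy']; apply: (tf (conj zy (conj yy zy'))).
rewrite /in_class /class; split; first by case: (adj z a && _); case: (adj z b && _); case: (_ && _).
move: (share _ _ av) (share _ _ vc) (share _ _ cu) (share _ _ ub) (share _ _ bw) (share _ _ wa).
by case: (adj z a); case: (adj z b); case: (adj z c); case: (adj z u); case: (adj z v);
  case: (adj z w).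
Qed.

Lemma vega_blowup_shift s a b c u v w x (h : T -> nat) n : s < 3 ->
  good_letters adj a b c u v w x -> 4 <= n ->
  (forall z, in_class adj a b c u v w z -> h z < n) ->
  (forall l, l < n -> exists2 z, in_class adj a b c u v w z & h z = l) ->
  (forall z, in_class adj a b c u v w z -> class adj a b c u v w z = (s + h z) %% 3) ->
  (forall z z', in_class adj a b c u v w z -> in_class adj a b c u v w z' ->
     adj z z' = word_adj (h z) (h z')) ->
  exists (i : nat) (mu nu : bool), 2 <= i /\ blowup_on adj (vega_adj i) (vega_vertices i mu nu).
Proof.
elim: s a b c u v w => [|s IH] a b c u v w lt_s good n_ge4 h_lt level col_h adj_h.
  exact: (vega_blowup adj_sym adj_irr tf common Q4 good h_lt level col_h adj_h n_ge4).
have rot z := class_rot z good.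
apply: (IH b c a v w u (ltnW lt_s) (good_letters_rot good) n_ge4).
- by move=> z; rewrite (rot z).1; apply: h_lt.
- by move=> l /level[z Dz hz]; exists z; rewrite // (rot z).1.
- move=> z; rewrite (rot z).1 => Dz; rewrite (rot z).2 // col_h //.
  by move: (h z); clear; lia.
by move=> z z'; rewrite !(rot _).1; apply: adj_h.
Qed.

Lemma vega_of_hexagon a b c u v w x : hexagon adj a b c u v w ->
  adj x a -> adj x b -> adj x c ->
  exists (i : nat) (mu nu : bool), 2 <= i /\ blowup_on adj (vega_adj i) (vega_vertices i mu nu).
Proof.
move=> hex xa xb xc; have gh := hexagon_gram7 adj_sym adj_irr tf hex xa xb xc.
have [s [gs gd]] := good_hexagon_exists a adj_sym adj_irr tf common Q4 gh.
have sz : size s = 11 by rewrite -(size_gram adj) gs.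
case: s sz gs gd => [|a1 [|b1 [|c1 [|u1 [|v1 [|w1 [|x1 [|p0 [|p1 [|p2 [|p3 [|]]]]]]]]]]]] // _.
set s := [:: a1; b1; c1; u1; v1; w1; x1; p0; p1; p2; p3] => gs.
rewrite [take 7 _]/= => /(good_letters_of_hexagon tf) good.
have E i j : i < 11 -> j < 11 -> adj (nth a s i) (nth a s j) = core_adj i j.
  move=> lt_i lt_j; have : nth false (nth [::] (gram adj s) i) j = core_adj i j.
    by rewrite gs /core !(nth_map 0) ?size_iota ?nth_iota.
  by rewrite (nth_map a) // (nth_map a).
have D0 : in_class adj a1 b1 c1 u1 v1 w1 p0 by rewrite /in_class (E 7 0) // (E 7 3).
have D1 : in_class adj a1 b1 c1 u1 v1 w1 p1 by rewrite /in_class (E 8 1) // (E 8 4) // orbT.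
have D2 : in_class adj a1 b1 c1 u1 v1 w1 p2 by rewrite /in_class (E 9 2) // (E 9 5) // !orbT.
have D3 : in_class adj a1 b1 c1 u1 v1 w1 p3 by rewrite /in_class (E 10 0) // (E 10 3).
have c0 : class adj a1 b1 c1 u1 v1 w1 p0 = 0 by rewrite /class (E 7 0) // (E 7 3).
have c1' : class adj a1 b1 c1 u1 v1 w1 p1 = 1 by rewrite /class (E 8 0) // (E 8 1) // (E 8 4).
have c2 : class adj a1 b1 c1 u1 v1 w1 p2 = 2 by rewrite /class (E 9 0) // (E 9 1).
have c3 : class adj a1 b1 c1 u1 v1 w1 p3 = 0 by rewrite /class (E 10 0) // (E 10 3).
have [|h [n [t [lt_t h_lt level col_h adj_h]]]] := word_structure adj_sym tf
  (D := in_class adj a1 b1 c1 u1 v1 w1) (fun z _ => class_lt adj a1 b1 c1 u1 v1 w1 z)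
  (class_adj adj_sym adj_irr tf good) (class_common adj_sym adj_irr tf common good)
  (class_no_rainbow adj_sym adj_irr tf common Q4 good); first by exists p0.
have n_ge4 : 4 <= n.
  have h01 : h p0 < h p1.
    by apply: (word_adj_up (t := t)); rewrite -?adj_h -?col_h ?c0 ?c1' // (E 7 8).
  have h12 : h p1 < h p2.
    by apply: (word_adj_up (t := t)); rewrite -?adj_h -?col_h ?c2 ?c1' // (E 8 9).
  have h23 : h p2 < h p3.
    by apply: (word_adj_up (t := t)); rewrite -?adj_h -?col_h ?c2 ?c3 // (E 9 10).
  by move: (h_lt _ D3) h01 h12 h23; clear; lia.
exact: (vega_blowup_shift lt_t good n_ge4 h_lt level col_h adj_h).
Qed.

Lemma property_Q_classification (x0 : T) :
  (exists k : nat, 1 <= k /\ blowup adj (andrasfai_adj k)) \/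
  (exists (i : nat) (mu nu : bool), 2 <= i /\ blowup_on adj (vega_adj i) (vega_vertices i mu nu)).
Proof.
have [hex|nohex] := boolP [exists a, exists b, exists c, exists u, exists v, exists w,
  hexagon adj a b c u v w]; [right|left].
  move: hex => /existsP[a /existsP[b /existsP[c /existsP[u /existsP[v /existsP[w hex]]]]]].
  have [t [[ta tb tc]|[tu tv tw]]] := hexagon_centre adj_sym adj_irr tf common Q4 hex.
    exact: (vega_of_hexagon hex ta tb tc).
  exact: (vega_of_hexagon (hexagon_swap adj_sym hex) tu tv tw).
apply: (andrasfai_blowup x0) => // a b c u v w; apply/negP => hex; case/negP: nohex.
by apply/existsP; exists a; apply/existsP; exists b; apply/existsP; exists c;
  apply/existsP; exists u; apply/existsP; exists v; apply/existsP; exists w.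
Qed.
End Main.

(** * Weights on Andrasfai and Vega graphs *)

Lemma subset_of_card (I : finType) (J : {set I}) k : k <= #|J| ->
  exists2 K : {set I}, K \subset J & #|K| = k.
Proof.
move=> le_k; exists [set x in take k (enum J)].
  by apply/subsetP => x; rewrite inE => /mem_take; rewrite mem_enum.
by rewrite cardsE (card_uniqP _) ?take_uniq ?enum_uniq // size_takel // -cardE.
Qed.

Lemma property_Q_of_weights (T : finType) (adj : rel T) (V : finType) (e : rel V) (S : pred V)
    (wt : V -> nat) (k : nat) :
  symmetric adj -> triangle_free adj -> blowup_on adj e S ->
  (forall v, S v -> \sum_(z | S z) wt z < 3 * \sum_(z | S z) wt z * e v z) ->
  property_Q k adj.
Proof.
move=> adj_sym tf [f [fS [f_onto fE]]] deg m /andP[m_gt0 _] s.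
have [z Sz lt_m] : exists2 z, S z & m < \sum_(i < 3 * m) e (f (s i)) z.
  apply/exists_inP; apply: contraT => /exists_inPn small; exfalso.
  set W := \sum_(z | S z) wt z in deg.
  have : \sum_(i < 3 * m) W.+1 <= \sum_(i < 3 * m) 3 * \sum_(z | S z) wt z * e (f (s i)) z.
    by apply: leq_sum => i _; apply: deg.
  rewrite sum_nat_const card_ord -big_distrr exchange_big /= leqNgt => /negP[].
  apply: (@leq_ltn_trans (3 * (m * W))); last by rewrite mulnA ltn_pmul2l // muln_gt0.
  rewrite leq_mul2l /= big_distrr /=; apply: leq_sum => z Sz.
  by rewrite -big_distrr /= mulnC leq_mul2r leqNgt small ?orbT.
have [z' fz'] := f_onto z Sz.
pose J := [set i | adj z' (s i)].
have cJ : #|J| = \sum_(i < 3 * m) e (f (s i)) z.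
  rewrite -sum1_card big_mkcond /=; apply: eq_bigr => i _.
  by rewrite inE adj_sym fE fz'; case: (e _ _).
have [|I /subsetP IJ cI] := @subset_of_card _ J m.+1; first by rewrite cJ.
exists I; split.
  move=> _ _ /imsetP[i /IJ iJ ->] /imsetP[j /IJ jJ ->]; move: iJ jJ; rewrite !inE => zi zj.
  apply/negP => ij; exact: (tf _ _ _ (conj zi (conj ij zj))).
right; split; first by rewrite cI addn1.
by exists z' => _ /imsetP[i /IJ iJ ->]; rewrite inE in iJ.
Qed.

Lemma sum_interval lo hi n : lo <= hi ->
  \sum_(d < n) ((lo <= d) && (d < hi)) = minn hi n - minn lo n.
Proof.
move=> le_lh; elim: n => [|n IH]; first by rewrite big_ord0 !minn0.
rewrite big_ord_recr /= IH; case: (leqP lo n) => h1; case: (ltnP n hi) => h2 /=.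
all: by move: le_lh h1 h2; clear; lia.
Qed.

Lemma circ_subK n (v z : 'I_n) : (v + n - (v + n - z) %% n) %% n = z.
Proof.
have [lt_v lt_z] := (ltn_ord v, ltn_ord z).
have n_gt0 : 0 < n by apply: leq_ltn_trans lt_v.
rewrite (circ_sub lt_v lt_z); case: leqP => le_zv.
  by rewrite circ_sub //; [case: leqP|]; move: lt_v lt_z le_zv; clear; lia.
by rewrite circ_sub //; [case: leqP|]; move: lt_v lt_z le_zv; clear; lia.
Qed.

Lemma andrasfai_degree k (v : 'I_(3 * k - 1)) : \sum_z andrasfai_adj k v z = k.
Proof.
have n_gt0 : 0 < 3 * k - 1 by apply: leq_ltn_trans (ltn_ord v).
pose phi (z : 'I_(3 * k - 1)) := Ordinal (ltn_pmod (v + (3 * k - 1) - z) n_gt0).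
have phiK : involutive phi by move=> z; apply: val_inj; apply: circ_subK.
rewrite (reindex_inj (inv_inj phiK)) /=.
rewrite (eq_bigr (fun d : 'I_(3 * k - 1) => nat_of_bool ((k <= d) && (d < 2 * k)))).
  by rewrite sum_interval; have := ltn_ord v; lia.
move=> d _; rewrite /andrasfai_adj /= circ_subK; congr nat_of_bool.
by have := ltn_ord v; lia.
Qed.

Lemma blowup_andrasfai_Q (T : finType) (adj : rel T) k m :
  symmetric adj -> triangle_free adj -> 1 <= k -> blowup adj (andrasfai_adj k) ->
  property_Q m adj.
Proof.
move=> adj_sym tf k_gt0 bl; apply: (property_Q_of_weights (wt := fun=> 1) adj_sym tf bl) => v _.
rewrite sum1_card card_ord (eq_bigr (fun z => nat_of_bool (andrasfai_adj k v z))); last first.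
  by move=> z _; rewrite mul1n.
by rewrite andrasfai_degree; move: k_gt0; clear; lia.
Qed.

Section VegaWeights.
Variables (i : nat).
Hypothesis i_ge2 : 2 <= i.

Definition num_weight (j : nat) : nat :=
  if j == 0 then 2 else if j == i then 4 else if j == 2 * i - 1 then 0 else 3.

Definition letter_weight (l : nat) : nat :=
  nth 0 [:: 3 * i; 3 * i - 1; 3 * i - 2; 3 * i - 1; 3 * i - 2; 3 * i - 3; 2; 0] l.

Definition vega_weight (p : 'I_(3 * i - 1) + 'I_8) : nat :=
  match p with inl j => num_weight j | inr l => letter_weight l end.

Lemma sum_point c (F : nat -> bool) : c < 3 * i - 1 ->
  \sum_(j < 3 * i - 1) (j == c :> nat) * F j = F c.
Proof.
move=> lt_c; rewrite (bigD1 (Ordinal lt_c)) //= eqxx mul1n big1 ?addn0 // => j.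
by rewrite -val_eqE /= => /negbTE->.
Qed.

Lemma num_weight_sum (F : nat -> bool) :
  \sum_(j < 3 * i - 1) num_weight j * F j + F 0 + 3 * F (2 * i - 1) =
  3 * (\sum_(j < 3 * i - 1) F j) + F i.
Proof.
rewrite -(@sum_point 0 F) -?(@sum_point i F) -?(@sum_point (2 * i - 1) F); try by move: i_ge2; clear; lia.
rewrite !big_distrr /= -!big_split /=; apply: eq_bigr => j _.
rewrite /num_weight; case: (F j); rewrite ?muln0 // !muln1.
by move: i_ge2; clear; case: eqP; case: eqP; case: eqP; lia.
Qed.

Lemma num_weight_interval lo hi (F : nat -> bool) : lo <= hi -> hi <= 3 * i - 1 ->
  (forall j, j < 3 * i - 1 -> F j = (lo <= j) && (j < hi)) ->
  \sum_(j < 3 * i - 1) num_weight j * F j + F 0 + 3 * F (2 * i - 1) = 3 * (hi - lo) + F i.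
Proof.
move=> le_lh le_hi FE; rewrite num_weight_sum; congr (3 * _ + _).
rewrite (eq_bigr (fun j : 'I__ => nat_of_bool ((lo <= j) && (j < hi)))) ?sum_interval //.
  by move: le_lh le_hi; clear; lia.
by move=> j _; rewrite FE.
Qed.

Lemma letter_num_sum l : l < 8 ->
  \sum_(j < 3 * i - 1) num_weight j * vega_letter_num i l j =
  nth 0 [:: 3 * i - 1; 3 * i - 2; 3 * i - 3; 3 * i - 1; 3 * i - 2; 3 * i - 3] l.
Proof.
pose N l := \sum_(j < 3 * i - 1) num_weight j * vega_letter_num i l j.
have A l' : l' \in [:: 0; 3] -> N l' = 3 * i - 1.
  rewrite !inE => l'E; have := @num_weight_interval 0 i (vega_letter_num i l').
  rewrite -/(N l') /vega_letter_num l'E; move: (N l') i_ge2; clear => m i2 h.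
  by have {}h := h (leq0n _) ltac:(lia) (fun j _ => erefl); lia.
have B l' : l' \in [:: 1; 4] -> N l' = 3 * i - 2.
  rewrite !inE => l'E; have := @num_weight_interval i (2 * i) (vega_letter_num i l').
  rewrite -/(N l') /vega_letter_num l'E.
  have -> : (l' == 0) || (l' == 3) = false by case/orP: l'E => /eqP->.
  move: (N l') i_ge2; clear => m i2 h.
  by have {}h := h ltac:(lia) ltac:(lia) ltac:(lia); lia.
have C l' : l' \in [:: 2; 5] -> N l' = 3 * i - 3.
  rewrite !inE => l'E; have := @num_weight_interval (2 * i) (3 * i - 1) (vega_letter_num i l').
  rewrite -/(N l') /vega_letter_num l'E.
  have [-> ->] : (l' == 0) || (l' == 3) = false /\ (l' == 1) || (l' == 4) = false.
    by case/orP: l'E => /eqP->.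
  move: (N l') i_ge2; clear => m i2 h.
  by have {}h := h ltac:(lia) ltac:(lia) ltac:(lia); lia.
have O l' : 5 < l' -> N l' = 0.
  by case: l' => [|[|[|[|[|[|l']]]]]] // _; rewrite /N big1 // => j _; rewrite muln0.
rewrite -/(N l); case: l => [|[|[|[|[|[|[|[|//]]]]]]]] _ /=; first [exact: A|exact: B|exact: C|exact: O].
Qed.

Lemma vega_letter_degree (l : 'I_8) :
  9 * i - 4 <= \sum_z vega_weight z * vega_adj i (inr l) z.
Proof.
rewrite big_sumType /= letter_num_sum // !big_ord_recl big_ord0 /=.
case: l => l lt_l; rewrite /= /vega_letter_adj /letter_weight.
move: l lt_l => [|[|[|[|[|[|[|[|//]]]]]]]] _ /=; rewrite /bump /= ?muln1 ?muln0.
all: by move: i_ge2; clear; lia.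
Qed.

Lemma vega_num_degree (v : 'I_(3 * i - 1)) :
  9 * i - 4 <= \sum_z vega_weight z * vega_adj i (inl v) z.
Proof.
rewrite big_sumType /=.
pose F (j : nat) := let d := (v + (3 * i - 1) - j) %% (3 * i - 1) in (i <= d) && (d <= 2 * i - 1).
pose N := \sum_(j < 3 * i - 1) num_weight j * F j.
have -> : \sum_(j < 3 * i - 1) num_weight j * andrasfai_adj i v j = N by [].
have := num_weight_sum F; rewrite -/N; move: N => N.
have -> : \sum_(j < 3 * i - 1) F j = i by apply: andrasfai_degree.
rewrite /F !circ_sub //; try by move: i_ge2; clear; lia.
rewrite !big_ord_recl big_ord0 /= /bump /= /vega_letter_num /letter_weight /=.
move: (nat_of_ord v) (ltn_ord v) i_ge2; clear => v' lt_v i2.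
have [lt_i|[r_i|ge_2i]] : v' < i \/ (i <= v' < 2 * i) \/ 2 * i <= v' by lia.
- have [-> ->] : (i <= v' <= 2 * i - 1) = false /\ (2 * i <= v' <= 3 * i - 2) = false by lia.
  by rewrite lt_i; do 2!case: ifP; lia.
- have [-> ->] : (i <= v' <= 2 * i - 1) = true /\ (2 * i <= v' <= 3 * i - 2) = false by lia.
  have -> : (v' < i) = false by lia.
  by do 2!case: ifP; lia.
have [-> ->] : (i <= v' <= 2 * i - 1) = false /\ (2 * i <= v' <= 3 * i - 2) = true by lia.
have -> : (v' < i) = false by lia.
by do 2!case: ifP; lia.
Qed.

Lemma vega_weight_total : \sum_z vega_weight z = 27 * i - 13.
Proof.
have numE : \sum_(j < 3 * i - 1) num_weight j = 9 * i - 6.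
  have := @num_weight_interval 0 (3 * i - 1) (fun=> true) (leq0n _) (leqnn _).
  rewrite (eq_bigr (fun j : 'I_(3 * i - 1) => num_weight j)) => [|j _]; last by rewrite /= muln1.
  move: (\sum_(j < _) _) i_ge2; clear => N i2 h.
  have {}h : N + 1 + 3 * 1 = 3 * (3 * i - 1 - 0) + 1 by apply: h => j ->.
  by move: h i2; clear; lia.
rewrite big_sumType /= numE !big_ord_recl big_ord0 /= /letter_weight /bump /=.
by move: i_ge2; clear; lia.
Qed.
End VegaWeights.

Lemma vega_blowup_Q (T : finType) (adj : rel T) i mu nu m :
  symmetric adj -> triangle_free adj -> 2 <= i ->
  blowup_on adj (vega_adj i) (vega_vertices i mu nu) -> property_Q m adj.
Proof.
move=> adj_sym tf i_ge2 bl.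
apply: (property_Q_of_weights (wt := @vega_weight i) adj_sym tf bl) => v _.
(* the deleted vertices have weight zero *)
have restr (F : _ -> nat) : \sum_(z | vega_vertices i mu nu z) vega_weight z * F z =
    \sum_z vega_weight z * F z.
  rewrite big_mkcond; apply: eq_bigr => z _; case: ifPn => //.
  case: z => [j|l] /=; rewrite negbK => /andP[_ /eqP] zE; rewrite zE.
    by rewrite /num_weight; case: eqP => [|_]; [lia|case: eqP => [|_]; [lia|rewrite eqxx]].
  by [].
have total : \sum_(z | vega_vertices i mu nu z) vega_weight z = 27 * i - 13.
  rewrite -(vega_weight_total i_ge2) -[RHS](eq_bigr _ (fun z _ => muln1 (vega_weight z))).
  by rewrite -restr; apply: eq_bigr => z _; rewrite muln1.
rewrite total restr; case: v => v.
  by have := vega_num_degree i_ge2 v; move: (\sum_z _) i_ge2; clear; lia.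
by have := vega_letter_degree i_ge2 v; move: (\sum_z _) i_ge2; clear; lia.
Qed.

Lemma maximal_common (T : finType) (adj : rel T) :
  symmetric adj -> irreflexive adj -> 2 <= #|T| -> maximal_triangle_free adj ->
  forall x y, ~~ adj x y -> exists z, adj z x && adj z y.
Proof.
move=> adj_sym adj_irr T_ge2 [tf maxl].
have neq_common x y : x != y -> ~~ adj x y -> exists z, adj z x && adj z y.
  move=> xy nxy; apply/existsP; apply: contraT => /existsPn no.
  have nadd p q : add_edge adj x y p q -> adj p q \/ (p = x /\ q = y) \/ (p = y /\ q = x).
    by case/orP => [/orP[|/andP[/eqP-> /eqP->]]|/andP[/eqP-> /eqP->]]; auto.
  have no' z : adj z x -> adj z y -> False by move=> zx zy; move: (no z); rewrite zx zy.
  have nyx : ~~ adj y x by rewrite adj_sym.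
  case: (maxl x y xy nxy) => p q r [/nadd pq [/nadd qr /nadd pr]].
  have sym p' q' : adj p' q' -> adj q' p' by rewrite adj_sym.
  case: pq => [pq|[] [? ?]]; case: qr => [qr|[] [? ?]]; case: pr => [pr|[] [? ?]]; subst;
    first [ by rewrite eqxx in xy | by rewrite adj_irr in pq | by rewrite adj_irr in qr
          | by rewrite adj_irr in pr | by case: (tf _ _ _ (conj pq (conj qr pr)))
          | by apply: (no' p); auto | by apply: (no' q); auto | by apply: (no' r); auto ].
move=> x y; have [<- _|] := eqVneq x y; last exact: neq_common.
have /card_gt1P[y1 [y2 [_ _ y12]]] : 1 < #|predT : pred T| := T_ge2.
have [z zx] : exists z, z != x.
  by have [<-|] := eqVneq y1 x; [exists y2; rewrite eq_sym|exists y1].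
have [zx'|/(neq_common _ _ zx)[t /andP[_ tx]]] := boolP (adj z x); first by exists z; rewrite zx'.
by exists t; rewrite tx.
Qed.

Theorem theorem5p1 (T : finType) (adj : rel T)
    (adj_sym : symmetric adj) (adj_irr : irreflexive adj)
    (T_ge2 : 2 <= #|T|)
    (mtf : maximal_triangle_free adj) :
  property_Q 4 adj <->
  ((exists k : nat, 1 <= k /\ blowup adj (andrasfai_adj k)) \/
   (exists (i : nat) (mu nu : bool),
      2 <= i /\ blowup_on adj (vega_adj i) (vega_vertices i mu nu))).
Proof.
have [tf _] := mtf; split=> [Q4|[[k [k_gt0 bl]]|[i [mu [nu [i_ge2 bl]]]]]].
- have [x0 _] : exists x0 : T, x0 \in T by apply/card_gt0P; apply: ltnW.
  exact: (property_Q_classification adj_sym adj_irr tf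
    (maximal_common adj_sym adj_irr T_ge2 mtf) Q4 x0).
- exact: blowup_andrasfai_Q bl.
- exact: vega_blowup_Q bl.
Qed.
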